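(* Let $X$ be a (real or complex) Banach space with a $1$-unconditional basis. Then the following three properties are equivalent: (i) $X$ has the alternative Daugavet property; (ii) $X$ is lush; (iii) $X$ has numerical index $1$.
   Context: A Schauder basis $(e_n)$ of $X$ is $1$-unconditional if $\|\sum_k\theta_kx_ke_k\|=\|\sum_kx_ke_k\|$ for every $\sum_k x_ke_k\in X$ and all signs $\theta_k\in\{-1,1\}$. $B_X$, $S_X$ are the closed unit ball and unit sphere of $X$, $\mathbb{T}$ is the set of scalars of modulus one, and $\overline{\mathrm{aconv}}(A)$ is the closed convex hull of $\mathbb{T}A$. Alternative Daugavet property (ADP): every rank-one bounded operator $T$ on $X$ satisfies $\max_{\theta\in\mathbb{T}}\|\mathrm{Id}+\theta T\|=1+\|T\|$. Lush: for all $x,y\in S_X$ and $\varepsilon>0$ there is $x^*\in S_{X^*}$ such that $x\in S:=\{z\in B_X:\operatorname{Re}x^*(z)>1-\varepsilon\}$ and $\operatorname{dist}(y,\overline{\mathrm{aconv}}(S))<\varepsilon$. Numerical index $1$: every bounded operator $T$ on $X$ satisfies $v(T)=\|T\|$, where $v(T)=\sup\{|x^*(Tx)|: x\in S_X,\ x^*\in S_{X^*},\ x^*(x)=1\}$ is the numerical radius. *)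

(* Defs.v *)
From HB Require Import structures.
From mathcomp Require Import all_boot all_order all_algebra.
From mathcomp Require Import all_classical all_reals all_analysis.
From mathcomp Require Export complex.
Set Implicit Arguments.
Unset Strict Implicit.
Unset Printing Implicit Defensive.
Import Order.TTheory GRing.Theory Num.Theory.
Import numFieldNormedType.Exports.
Local Open Scope classical_set_scope.
Local Open Scope ring_scope.

(* Everything is stated over a numFieldType K, to be used with K a realType R
   or K = R[i]. Norms take their values in K, and on R[i] the order is the
   partial order z <= w <-> w - z is a nonnegative real. Hence any upper bound
   of a nonempty set of norms is real, and [supremum] and [infimum] of sets of
   norms agree with the real ones, with value 0 on the empty set. *)

Definition unit_scalars (K : numFieldType) : set K := [set t | `|t| = 1].

Definition unit_ball (K : numFieldType) (X : normedModType K) : set X :=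
  [set x | `|x| <= 1].

Definition unit_sphere (K : numFieldType) (X : normedModType K) : set X :=
  [set x | `|x| = 1].

Definition opnorm (K : numFieldType) (X Y : normedModType K) (f : X -> Y) : K :=
  supremum 0 [set `|f x| | x in @unit_ball K X].

(* X^* consists of the continuous f : {linear X -> K^o}. *)
Definition dual_sphere (K : numFieldType) (X : normedModType K) :
    set {linear X -> K^o} :=
  [set f | continuous f /\ opnorm f = 1].

Definition dist (K : numFieldType) (X : normedModType K) (y : X) (A : set X) : K :=
  infimum 0 [set `|y - z| | z in A].

Definition closed_aconv (K : numFieldType) (X : normedModType K) (A : set X) :
    set X :=
  smallest [set C : set X | closed C /\ convex_set C]
    [set t *: z | t in @unit_scalars K & z in A].

(* A basis is either a sequence or a finite family; in the latter case only the
   entries e k with k in I = `I_n are meaningful. *)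
Definition basis_index (I : set nat) : Prop :=
  I = setT \/ exists n : nat, I = `I_n.

Definition expansion (K : numFieldType) (X : normedModType K) (I : set nat)
    (e : nat -> X) (a : nat -> K) (x : X) : Prop :=
  (forall k, ~ I k -> a k = 0) /\
  series (fun k => a k *: e k) @ \oo --> x.

Definition schauder_basis (K : numFieldType) (X : normedModType K)
    (I : set nat) (e : nat -> X) : Prop :=
  basis_index I /\ forall x : X, exists! a : nat -> K, expansion I e a x.

Definition one_unconditional (K : numFieldType) (X : normedModType K)
    (I : set nat) (e : nat -> X) : Prop :=
  forall (x : X) (a : nat -> K), expansion I e a x ->
  forall theta : nat -> K, (forall k, theta k = 1 \/ theta k = -1) ->
  exists2 y : X, expansion I e (fun k => theta k * a k) y & `|y| = `|x|.

Definition has_one_unconditional_basis (K : numFieldType) (X : normedModType K) :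
    Prop :=
  exists (I : set nat) (e : nat -> X),
    schauder_basis I e /\ one_unconditional I e.

Definition rank_one (K : numFieldType) (X Y : normedModType K) (f : X -> Y) :
    Prop :=
  exists2 v : Y, v != 0 & range f = range (fun a : K => a *: v).

Definition is_maximum (K : numFieldType) (A : set K) (m : K) : Prop :=
  A m /\ ubound A m.

Definition alternative_Daugavet (K : numFieldType) (X : normedModType K) : Prop :=
  forall T : {linear X -> X}, continuous T -> rank_one T ->
  is_maximum [set opnorm (fun x : X => x + t *: T x) | t in @unit_scalars K]
    (1 + opnorm T).

(* re is the real part K -> K: the identity for real scalars, 'Re for complex
   ones. When K = R[i], 0 < eps forces eps to be real. *)
Definition slice (K : numFieldType) (re : K -> K) (X : normedModType K)
    (f : X -> K) (eps : K) : set X :=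
  [set z | @unit_ball K X z /\ 1 - eps < re (f z)].

Definition lush (K : numFieldType) (re : K -> K) (X : normedModType K) : Prop :=
  forall x y : X, unit_sphere x -> unit_sphere y ->
  forall eps : K, 0 < eps ->
  exists f : {linear X -> K^o},
    [/\ dual_sphere f, slice re f eps x &
        dist y (closed_aconv (slice re f eps)) < eps].

Definition numerical_radius (K : numFieldType) (X : normedModType K)
    (T : X -> X) : K :=
  supremum 0 [set r : K | exists (x : X) (f : {linear X -> K^o}),
    [/\ unit_sphere x, dual_sphere f, f x = 1 & r = `|f (T x)|]].

Definition numerical_index_one (K : numFieldType) (X : normedModType K) : Prop :=
  forall T : {linear X -> X}, continuous T -> numerical_radius T = opnorm T.

(* Main.v *)
From HB Require Import structures.
Require Import Defs.
From mathcomp Require Import all_boot all_order all_algebra.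
From mathcomp Require Import all_classical all_reals all_analysis.
From mathcomp Require Import complex.
From mathcomp Require Import ring lra.
Import Order.TTheory GRing.Theory Num.Theory numFieldNormedType.Exports.
Local Open Scope classical_set_scope.
Local Open Scope ring_scope.
Local Open Scope complex_scope.
Set Implicit Arguments.
Unset Strict Implicit.
Unset Printing Implicit Defensive.

(** Two of the three implications hold in every normed space.

    Lush implies numerical index one.  Take a unit vector x nearly norming T,
    put y = Tx / |Tx|, and let f be given by lushness for the pair (y, x).
    As f(Tx) is nearly |T| and x is nearly in the closed absolutely convex
    hull of the slice of f around y, some z in the slice has |f(Tz)| nearly
    |T|, while f(z) is nearly 1.  The pair (z, f) only satisfies f(z) = 1
    approximately, but no perturbation theorem is needed: by Lumer's estimate
    (lumer), the numerical radius nu of T controls |Id + kT| up to second order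
    in k, and |z + kTz| >= 1 + |k| |T| - small for a suitable phase of k.

    Numerical index one implies the alternative Daugavet property.  If
    f(x) = 1 and |f(Tx)| is nearly |T|, a unit scalar t aligning f(Tx) gives
    |x + tTx| >= 1 + |f(Tx)|; compactness of the unit circle
    (unit_circle_max) yields a t that attains the supremum.

    The alternative Daugavet property implies lush.  This is where the basis is
    used.  Applied to the operators f(.)u, the property says that any nonzero
    vector u can be extended: every slice of the ball contains a z with
    |u + tz| nearly |u| + 1 for some unit t (ADP_extend).  Starting at x and
    choosing slices one after the other, one reaches vectors
    x + t_1 z_1 + ... + t_k z_k of norm nearly k + 1.  A norming functional g
    of such a sum is nearly 1 on x and on every t_i z_i, so x and the t_i z_i
    lie in one slice of g, and lushness follows as soon as the slices can be
    chosen so that y is nearly in the absolutely convex hull of the answers z_i.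

    It remains to win this game against an opponent who answers a slice by an
    arbitrary point of it (forcing_dense).  Finitely many coordinates of the
    answers can be prescribed on average by a Frank-Wolfe iteration
    (force_coordinates), but the tails cannot.  They are cancelled by
    unconditionality: if averages p of answers agree with the target y up to a
    tail, then y minus that tail is nearly the reflection of p, so it again lies
    in the unit ball and can serve as the next target.  The average of j
    successive p's then differs from y by a single tail divided by j.

    Both scalar fields are treated at once, through the data of real_form; real
    inequalities are stated for the real-valued norm nrm. *)

(** * Real and complex scalars *)

(** A uniform description of the field K = R (with [im_unit = 0]) and K = R[i]
    (with [im_unit = 'i]): [inc] embeds R, [rp] is the real part, and the
    imaginary part of k is [- rp (im_unit * k)] in both cases. *)
Record real_form (R : realType) (K : numFieldType) := RealForm {
  inc : {rmorphism R -> K};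
  rp : {additive K -> R};
  im_unit : K;
  inc_le : forall a b, (inc a <= inc b) = (a <= b);
  rp_incM : forall a k, rp (inc a * k) = a * rp k;
  rp1 : rp 1 = 1;
  sqr_norm_rp : forall k, `|k| ^+ 2 = inc (rp k ^+ 2 + rp (im_unit * k) ^+ 2);
  inc_rp_ge0 : forall k, 0 <= k -> inc (rp k) = k;
  re_im_split : forall k, k = inc (rp k) - im_unit * inc (rp (im_unit * k));
  im_unit_cases : im_unit = 0 \/ im_unit * im_unit = -1 }.

Section RealNorm.
Context (R : realType) (K : numFieldType) (S : real_form R K).

Lemma rp_inc a : rp S (inc S a) = a.
Proof. by rewrite -[inc S a]mulr1 rp_incM rp1 mulr1. Qed.

Lemma inc_lt a b : (inc S a < inc S b) = (a < b).
Proof. by rewrite !lt_neqAle inc_le (inj_eq (can_inj rp_inc)). Qed.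

(** On R[i]-modules the norm takes its values in R[i]; its real part is the
    usual real-valued norm, for which linear arithmetic is available. *)
Definition nrm (V : normedZmodType K) (x : V) : R := rp S `|x|.

Section Norm.
Context (V : normedZmodType K).
Implicit Types x y : V.

Lemma inc_nrm x : inc S (nrm x) = `|x|.
Proof. exact: inc_rp_ge0. Qed.

Lemma nrm_le_inc x a : (nrm x <= a) = (`|x| <= inc S a).
Proof. by rewrite -inc_nrm inc_le. Qed.

Lemma nrm_lt_inc x a : (nrm x < a) = (`|x| < inc S a).
Proof. by rewrite -inc_nrm inc_lt. Qed.

Lemma nrm_eq_inc x a : (nrm x == a) = (`|x| == inc S a).
Proof. by rewrite -inc_nrm (inj_eq (can_inj rp_inc)). Qed.

Lemma nrm_ge0 x : 0 <= nrm x.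
Proof. by rewrite -(inc_le S) rmorph0 inc_nrm. Qed.

Lemma nrmD x y : nrm (x + y) <= nrm x + nrm y.
Proof. by rewrite -(inc_le S) rmorphD !inc_nrm ler_normD. Qed.

Lemma nrmN x : nrm (- x) = nrm x.
Proof. by rewrite /nrm normrN. Qed.

Lemma nrmB x y : nrm (x - y) <= nrm x + nrm y.
Proof. by rewrite -[nrm y]nrmN nrmD. Qed.

Lemma nrm_distC x y : nrm (x - y) = nrm (y - x).
Proof. by rewrite -nrmN opprB. Qed.

Lemma nrm_dist_le x y : nrm x - nrm y <= nrm (x - y).
Proof. by rewrite lerBlDr -{1}(subrK y x) nrmD. Qed.

Lemma nrm0 : nrm (0 : V) = 0.
Proof. by rewrite /nrm normr0 raddf0. Qed.

Lemma nrm_eq0 x : (nrm x == 0) = (x == 0).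
Proof. by rewrite nrm_eq_inc rmorph0 normr_eq0. Qed.

Lemma nrm_gt0 x : (0 < nrm x) = (x != 0).
Proof. by rewrite lt_neqAle nrm_ge0 andbT eq_sym nrm_eq0. Qed.

End Norm.

Lemma nrmM (a b : K) : nrm (a * b) = nrm a * nrm b.
Proof. by rewrite /nrm normrM -{1}(inc_nrm a) rp_incM. Qed.

Lemma nrm_inc a : nrm (inc S a) = `|a|.
Proof.
apply/eqP; have [a0|a0] := leP 0 a.
  by rewrite nrm_eq_inc !ger0_norm // -(rmorph0 (inc S)) inc_le.
rewrite nrm_eq_inc (ltr0_norm a0) ltr0_norm ?rmorphN //.
by rewrite -(rmorph0 (inc S)) inc_lt.
Qed.

Lemma sqr_nrm (k : K) : nrm k ^+ 2 = rp S k ^+ 2 + rp S (im_unit S * k) ^+ 2.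
Proof. by apply: (can_inj rp_inc); rewrite rmorphXn /= inc_nrm (sqr_norm_rp S). Qed.

Lemma norm_rp_le k : `|rp S k| <= nrm k.
Proof.
rewrite -(ler_pXn2r (n := 2)) ?nnegrE ?nrm_ge0 // real_normK ?num_real //.
by rewrite sqr_nrm lerDl sqr_ge0.
Qed.

Lemma rp_le_nrm k : rp S k <= nrm k.
Proof. exact: le_trans (ler_norm _) (norm_rp_le k). Qed.

Lemma rp_im_unit : rp S (im_unit S) = 0.
Proof.
have [->|j0] := eqVneq (im_unit S) 0; first by rewrite raddf0.
have /eqP := re_im_split S 1; rewrite rp1 rmorph1 mulr1 eq_sym subr_eq addrC -subr_eq subrr.
by rewrite eq_sym mulf_eq0 (negbTE j0) -(rmorph0 (inc S)) (inj_eq (can_inj rp_inc)) => /eqP.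
Qed.

(** Equality in [rp k <= nrm k] forces the imaginary part to vanish, because
    [nrm k ^+ 2] is the sum of the squares of both parts. *)
Lemma rp_eq_nrm (k : K) : rp S k = nrm k -> k = inc S (nrm k).
Proof.
move=> kE; have := sqr_nrm k; rewrite kE -{1}[_ ^+ 2]addr0 => /addrI/esym/eqP.
rewrite sqrf_eq0 => /eqP rjk.
by rewrite {1}(re_im_split S k) rjk rmorph0 mulr0 subr0 kE.
Qed.

Lemma nrm1 : nrm (1 : K) = 1.
Proof. by rewrite /nrm normr1 rp1. Qed.

Lemma nrm_im_unit : nrm (im_unit S) <= 1.
Proof.
case: (im_unit_cases S) => [->|jj2]; first by rewrite nrm0.
have : nrm (im_unit S) * nrm (im_unit S) = 1 by rewrite -nrmM jj2 nrmN nrm1.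
have := nrm_ge0 (im_unit S); nra.
Qed.

Lemma unit_nrm (t : K) : unit_scalars t -> nrm t = 1.
Proof. by move=> t1; rewrite /nrm t1 rp1. Qed.

Lemma exists_phase (k : K) : exists2 t : K, unit_scalars t & t * k = inc S (nrm k).
Proof.
have [->|k0] := eqVneq k 0.
  by exists 1; [rewrite /unit_scalars/= normr1|rewrite mulr0 nrm0 rmorph0].
exists (`|k| / k); last by rewrite divfK // inc_nrm.
by rewrite /unit_scalars/= normrM normfV normr_id divff // normr_eq0.
Qed.

Lemma unit_scalarsM (s t : K) : unit_scalars s -> unit_scalars t -> unit_scalars (s * t).
Proof. by rewrite /unit_scalars/= normrM => -> ->; rewrite mulr1. Qed.

Lemma unit_scalarsV (t : K) : unit_scalars t -> unit_scalars t^-1.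
Proof. by rewrite /unit_scalars/= normfV => ->; rewrite invr1. Qed.

Section Mod.
Context (X : normedModType K).
Implicit Types x y : X.

Lemma nrmZ k x : nrm (k *: x) = nrm k * nrm x.
Proof. by rewrite /nrm normrZ -{1}(inc_nrm k) rp_incM. Qed.

Lemma nrmZ_inc a x : nrm (inc S a *: x) = `|a| * nrm x.
Proof. by rewrite nrmZ nrm_inc. Qed.

Lemma nrmZ_unit t x : unit_scalars t -> nrm (t *: x) = nrm x.
Proof. by move=> t1; rewrite nrmZ unit_nrm // mul1r. Qed.

Lemma unit_ballE x : unit_ball x <-> nrm x <= 1.
Proof. by rewrite nrm_le_inc rmorph1. Qed.

Lemma unit_sphereE x : unit_sphere x <-> nrm x = 1.
Proof.
split=> [xS|/eqP]; first by rewrite /nrm xS rp1.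
by rewrite nrm_eq_inc rmorph1 => /eqP.
Qed.

End Mod.

(** Upper bounds in K of a nonempty set of nonnegative elements are real, so
    that its supremum in the partial order of K is the real one. *)
Lemma supremum_inc (A : set K) (M : R) : A !=set0 -> (forall a, A a -> 0 <= a) ->
  (forall a, A a -> rp S a <= M) ->
  [/\ supremum 0 A = inc S (sup [set rp S a | a in A]),
      (forall a, A a -> rp S a <= sup [set rp S a | a in A]) &
      (forall m, (forall a, A a -> rp S a <= m) -> sup [set rp S a | a in A] <= m)].
Proof.
move=> A0 Age0 AM; set s := sup _.
have img0 : [set rp S a | a in A] !=set0 by case: A0 => a Aa; exists (rp S a), a.
have ubA a : A a -> rp S a <= s.
  by move=> Aa; apply: ub_le_sup; [exists M => _ [b /AM bM <-]|exists a].
have lubA m : (forall a, A a -> rp S a <= m) -> s <= m.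
  by move=> Am; apply: sup_le_ub => // _ [b /Am bM <-].
split => //; rewrite /supremum.
case: ifPn => [/eqP A00|_]; first by case: A0 => a; rewrite A00.
have supA : supremums A (inc S s).
  split=> [a Aa|u uA]; first by rewrite -(inc_rp_ge0 S (Age0 _ Aa)) inc_le ubA.
  case: A0 => a Aa.
  have u0 : 0 <= u by apply: le_trans (uA _ Aa); exact: Age0.
  rewrite -(inc_rp_ge0 S u0) inc_le; apply: lubA => b Ab.
  by rewrite -(inc_le S) !inc_rp_ge0 //; [exact: uA|exact: Age0].
by case: xgetP => [y _ yA|/(_ (inc S s))//]; apply: is_subset1_supremums yA supA.
Qed.

(** A lower bound in K need not be nonnegative, but it is comparable with an
    element of the set and therefore real. *)
Lemma infimum_inc (A : set K) : A !=set0 -> (forall a, A a -> 0 <= a) ->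
  infimum 0 A = inc S (inf [set rp S a | a in A]).
Proof.
move=> [a0 Aa0] Age0; set i := inf _.
have lbi : lbound [set rp S a | a in A] 0.
  by move=> _ [b /Age0 b0 <-]; rewrite -(inc_le S) rmorph0 inc_rp_ge0.
have lei u : (forall a, A a -> inc S u <= a) -> u <= i.
  move=> uA; apply: lb_le_inf; first by exists (rp S a0), a0.
  by move=> _ [b Ab <-]; rewrite -(inc_le S) inc_rp_ge0; [exact: uA|exact: Age0].
have infA : infimums A (inc S i).
  split=> [b Ab|u uA].
    rewrite -(inc_rp_ge0 S (Age0 _ Ab)) inc_le; apply: ge_inf; first by exists 0.
    by exists b.
  have ur : u \is Num.real.
    rewrite -(subrK a0 u) -[u - _]opprB rpredD ?rpredN //; last exact/ger0_real/Age0.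
    by apply: ger0_real; rewrite subr_ge0; apply: uA.
  have [u0|u0] := real_ge0P ur.
    by rewrite -(inc_rp_ge0 S u0) inc_le; apply: lei => a Aa; rewrite inc_rp_ge0 // uA.
  apply: le_trans (ltW u0) _; rewrite -(rmorph0 (inc S)) inc_le; apply: lei => a Aa.
  by rewrite rmorph0 Age0.
rewrite /infimum; case: ifPn => [/eqP A0|_]; first by rewrite A0 in Aa0.
by case: xgetP => [w _ wA|/(_ (inc S i))//]; apply: is_subset1_infimums wA infA.
Qed.

Lemma dist_ltP (X : normedModType K) (y : X) (A : set X) (e : R) : A !=set0 ->
  dist y A < inc S e <-> exists2 z, A z & nrm (y - z) < e.
Proof.
move=> [z0 Az0]; rewrite /dist infimum_inc ?inc_lt; first last.
- by move=> _ [z _ <-].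
- by exists `|y - z0|, z0.
have inf0 : has_inf [set rp S a | a in [set `|y - z| | z in A]].
  split; first by exists (nrm (y - z0)), `|y - z0| => //; exists z0.
  by exists 0 => _ [_ [z _ <-] <-]; exact: nrm_ge0.
split=> [/(inf_lt inf0.1)[_ [_ [z Az <-] <-] ze]|[z Az]]; first by exists z.
apply: le_lt_trans; apply: ge_inf; first by case: inf0.
by exists `|y - z| => //; exists z.
Qed.

End RealNorm.

(** * The Hahn-Banach theorem *)

Section HahnBanach.
Context (R : realType) (K : numFieldType) (S : real_form R K) (X : lmodType K).
Implicit Types (p q : X -> R) (x y : X) (t : R).

Definition sublinear p :=
  (forall x y, p (x + y) <= p x + p y) /\
  (forall t x, 0 <= t -> p (inc S t *: x) = t * p x).

(** Scaling by t and by its inverse turns the inequality into an equality. *)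
Lemma pos_homogeneous q : q 0 = 0 ->
  (forall t x, 0 < t -> q (inc S t *: x) <= t * q x) ->
  forall t x, 0 <= t -> q (inc S t *: x) = t * q x.
Proof.
move=> q0 qle t x; rewrite le_eqVlt => /predU1P[<-|t0].
  by rewrite rmorph0 scale0r mul0r.
apply/eqP; rewrite eq_le qle //=.
have ti0 : 0 < t^-1 by rewrite invr_gt0.
have := qle _ (inc S t *: x) ti0.
rewrite scalerA -rmorphM mulVf ?gt_eqF // rmorph1 scale1r.
by rewrite -ler_pdivrMl ?invr_gt0 // invrK.
Qed.

Lemma sublinear0 p : sublinear p -> p 0 = 0.
Proof. by case=> _ /(_ 0 0 (lexx _)); rewrite scaler0 mul0r. Qed.

Lemma sublinear_lbound p x : sublinear p -> - p (- x) <= p x.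
Proof.
move=> sp; have := sp.1 x (- x); rewrite subrr (sublinear0 sp); lra.
Qed.

(** The functional q x = inf over t >= 0 of p (x + t y) - t (p y) lies below p
    and satisfies q (- y) <= - p y: passing from p to q makes it linear in the
    direction y without changing its value at y. *)
Lemma sublinear_tilt p y : sublinear p ->
  exists2 q, sublinear q & (forall x, q x <= p x) /\
    (forall t x, 0 <= t -> q x <= p (x + inc S t *: y) - t * p y).
Proof.
move=> sp; have [pD pZ] := sp.
pose A x := [set p (x + inc S t *: y) - t * p y | t in [set t | 0 <= t]].
pose q x := inf (A x).
have Alb x : lbound (A x) (- p (- x)).
  move=> _ [t t0 <-]; rewrite -pZ //.
  have := pD (x + inc S t *: y) (- x); rewrite addrAC subrr add0r; lra.
have Ainf x : has_inf (A x).
  split; last by exists (- p (- x)).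
  by exists (p (x + inc S 0 *: y) - 0 * p y), 0 => /=.
have qle t x : 0 <= t -> q x <= p (x + inc S t *: y) - t * p y.
  by move=> t0; apply: ge_inf; [exact: (Ainf x).2|exists t].
have leq x m : (forall t, 0 <= t -> m <= p (x + inc S t *: y) - t * p y) -> m <= q x.
  by move=> mA; apply: lb_le_inf; [exact: (Ainf x).1|move=> _ [t t0 <-]; exact: mA].
exists q; last first.
  split=> // x; have := qle 0 x.
  by rewrite rmorph0 scale0r addr0 mul0r subr0; apply.
split=> [x1 x2|].
  rewrite -lerBlDr; apply: (leq _) => t t0; rewrite lerBlDr -lerBlDl. apply: (leq x2) => s s0.
  have := qle (t + s) (x1 + x2) (addr_ge0 t0 s0).
  have := pD (x1 + inc S t *: y) (x2 + inc S s *: y).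
  rewrite addrACA -scalerDl -rmorphD; lra.
apply: pos_homogeneous.
  apply/eqP; rewrite eq_le; apply/andP; split.
    by have := qle 0 0; rewrite rmorph0 scale0r addr0 mul0r subr0 (sublinear0 sp); apply.
  by apply: (leq _) => t t0; rewrite add0r pZ // subrr.
move=> t x t0; rewrite -ler_pdivrMl //; apply: (leq _) => s s0; rewrite ler_pdivrMl //.
have := qle (t * s) (inc S t *: x) (mulr_ge0 (ltW t0) s0).
by rewrite rmorphM -scalerA -scalerDr pZ ?(ltW t0) // mulrBr mulrA.
Qed.

(** The infimum of a chain of sublinear functionals is sublinear, and it is
    finite since all of them lie above [x |-> - p (- x)]; so Zorn's lemma
    applies. *)
Lemma minimal_sublinear p : sublinear p ->
  exists q, [/\ sublinear q, forall x, q x <= p x &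
    forall r, sublinear r -> (forall x, r x <= q x) -> r = q].
Proof.
move=> sp; pose T := {q | sublinear q /\ forall x, q x <= p x}.
pose r (a b : T) := `[< forall x, sval b x <= sval a x >].
have [|||A totA|[q [sq qp]] qmin] := @Zorn T r.
- by move=> a; apply/asboolP.
- move=> a b c /asboolP ab /asboolP bc; apply/asboolP => x.
  exact: le_trans (bc x) (ab x).
- move=> [a pa] [b pb] /asboolP/= ab /asboolP/= ba; apply: eq_exist.
  by apply/funext => x; apply/eqP; rewrite eq_le ab ba.
- have [[a0 Aa0]|noA] := pselect (A !=set0); last first.
    exists (exist _ p (conj sp (fun x => lexx _))) => s As.
    by case: noA; exists s.
  pose B x := [set sval a x | a in A]; pose q x := inf (B x).
  have Binf x : has_inf (B x).
    split; first by exists (sval a0 x), a0.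
    exists (- p (- x)) => _ [[a [sa ap]] _ <-] /=.
    by apply: le_trans (sublinear_lbound x sa); rewrite lerN2.
  have qle a x : A a -> q x <= sval a x.
    by move=> Aa; apply: ge_inf; [exact: (Binf x).2|exists a].
  have leq x m : (forall a, A a -> m <= sval a x) -> m <= q x.
    by move=> mA; apply: lb_le_inf; [exact: (Binf x).1|move=> _ [a Aa <-]; exact: mA].
  have sq : sublinear q.
    split=> [x y|].
      rewrite -lerBlDr; apply: (leq _) => a Aa; rewrite lerBlDr -lerBlDl.
      apply: (leq _) => b Ab; rewrite lerBlDr.
      case: (totA _ _ Aa Ab) => /asboolP ab.
        apply: (le_trans (qle b _ Ab)); apply: (le_trans ((svalP b).1.1 _ _)).
        by rewrite addrC lerD2l ab.
      apply: (le_trans (qle a _ Aa)); apply: (le_trans ((svalP a).1.1 _ _)).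
      by rewrite addrC lerD2r ab.
    apply: pos_homogeneous.
      apply/eqP; rewrite eq_le; apply/andP; split.
        by apply: (le_trans (qle a0 0 Aa0)); rewrite (sublinear0 (svalP a0).1).
      by apply: (leq _) => a Aa; rewrite (sublinear0 (svalP a).1).
    move=> t x t0; rewrite -ler_pdivrMl //; apply: (leq _) => a Aa; rewrite ler_pdivrMl //.
    by apply: (le_trans (qle a _ Aa)); rewrite (svalP a).1.2 // ltW.
  have qp x : q x <= p x.
    exact: le_trans (qle a0 x Aa0) ((svalP a0).2 x).
  by exists (exist _ q (conj sq qp)) => a Aa; apply/asboolP => x /=; exact: qle.
exists q; split=> // s ss sq'.
have sp' x : s x <= p x by exact: le_trans (sq' x) (qp x).
have /(_ _)/(congr1 sval)/= := qmin (exist _ s (conj ss sp')).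
by apply; apply/asboolP.
Qed.

(** A minimal sublinear functional below the tilt of p at x0 coincides with
    each of its own tilts, hence is additive; lying below the tilt of p, it
    takes at - x0 a value of at most - p x0. *)
Lemma hahn_banach p x0 : sublinear p ->
  exists g, [/\ sublinear g, forall x y, g (x + y) = g x + g y,
    forall x, g x <= p x & g x0 = p x0].
Proof.
move=> sp; have [p' sp' [p'p p'x]] := sublinear_tilt x0 sp.
have [g [sg gp' gmin]] := minimal_sublinear sp'.
have gD x y : g (x + y) = g x + g y.
  apply/eqP; rewrite eq_le sg.1 /=.
  have [q sq [qg qy]] := sublinear_tilt y sg.
  have := qy 1 x ler01; rewrite (gmin _ sq qg) rmorph1 scale1r mul1r; lra.
exists g; split=> // [x|]; first exact: le_trans (gp' x) (p'p x).
apply/eqP; rewrite eq_le (le_trans (gp' x0) (p'p x0)) /=.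
have := le_trans (gp' (- x0)) (p'x 1 _ ler01).
have := sublinear_lbound (- x0) sg.
rewrite opprK rmorph1 scale1r addNr mul1r (sublinear0 sp); lra.
Qed.

End HahnBanach.

(** * Bounded maps, operator norms and norming functionals *)

Section BoundedMap.
Context (R : realType) (K : numFieldType) (S : real_form R K).
Local Notation N := (nrm S).

Definition bounded_map (X Y : normedModType K) (f : X -> Y) :=
  exists C : R, forall x, N (f x) <= C * N x.

Lemma pack_linear (X : lmodType K) (f : X -> K) :
  linear (f : X -> K^o) -> exists g : {linear X -> K^o}, g = f :> (X -> K).
Proof.
move=> lf.
pose g : {linear X -> K^o} :=
  HB.pack (f : X -> K^o) (GRing.isLinear.Build _ _ _ _ (f : X -> K^o) lf).
by exists g.
Qed.

Lemma continuous_bounded_map (X Y : normedModType K) (f : {linear X -> Y}) :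
  continuous f <-> bounded_map f.
Proof.
apply: (iff_trans (iff_sym (linear_bounded_continuous f))).
split=> [/linear_boundedP [M [Mr fM]]|[C fC]].
  exists (rp S `|M| + 1) => x.
  rewrite -(inc_le S) rmorphM !inc_nrm; apply: fM.
  rewrite rmorphD rmorph1 inc_rp_ge0 //.
  by apply: le_lt_trans (real_ler_norm Mr) _; rewrite ltrDl.
apply/linear_boundedP; exists (inc S C); split.
  have [C0|C0] := leP 0 C.
    by apply: ger0_real; rewrite -(rmorph0 (inc S)) inc_le.
  by apply: ler0_real; rewrite -(rmorph0 (inc S)) inc_le ltW.
move=> r Cr x; apply: le_trans (ler_wpM2r (normr_ge0 _) (ltW Cr)).
by rewrite -!(inc_nrm S) -rmorphM inc_le.
Qed.

Definition opN (X Y : normedModType K) (f : X -> Y) : R := rp S (opnorm f).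

Section OpNorm.
Context (X Y : normedModType K).

(** Stated for arbitrary maps bounded on the ball, as it is also applied to
    the unbundled maps [fun x => x + t *: T x]. *)
Lemma opnormP (f : X -> Y) (M : R) : (forall x, N x <= 1 -> N (f x) <= M) ->
  [/\ opnorm f = inc S (opN f), (forall x, N x <= 1 -> N (f x) <= opN f) &
    forall m, (forall x, N x <= 1 -> N (f x) <= m) -> opN f <= m].
Proof.
move=> fM; have [||_ [x xB <-]|supE ubf lubf] :=
    @supremum_inc R K S [set `|f x| | x in @unit_ball K X] M.
- by exists `|f 0|, 0 => //=; rewrite /unit_ball/= normr0.
- by move=> _ [x _ <-].
- by apply: fM; apply/unit_ballE.
rewrite /opN /opnorm supE rp_inc; split=> // [x /unit_ballE x1|m fm].
  by apply: ubf; exists x.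
by apply: lubf => _ [x /(unit_ballE S) x1 <-]; exact: fm.
Qed.

Context (f : {linear X -> Y}) (fb : bounded_map f).

Let fM : exists M, forall x, N x <= 1 -> N (f x) <= M.
Proof.
have [C fC] := fb; exists `|C| => x x1.
apply: (le_trans (fC x)); apply: (le_trans (ler_wpM2r (nrm_ge0 S x) (ler_norm C))).
by rewrite ler_piMr.
Qed.

Lemma opnorm_inc : opnorm f = inc S (opN f).
Proof. by have [M /opnormP[]] := fM. Qed.

Lemma opN_ball x : N x <= 1 -> N (f x) <= opN f.
Proof. by have [M /opnormP[_ + _]] := fM; apply. Qed.

Lemma opN_lub m : (forall x, N x <= 1 -> N (f x) <= m) -> opN f <= m.
Proof. by have [M /opnormP[_ _ +]] := fM; apply. Qed.

Lemma opN_ge0 : 0 <= opN f.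
Proof. by apply: le_trans (opN_ball (x := 0) _); rewrite ?nrm_ge0 // nrm0. Qed.

Lemma opN_le x : N (f x) <= opN f * N x.
Proof.
have [->|x0] := eqVneq x 0; first by rewrite linear0 !nrm0 mulr0.
have Nx0 : 0 < N x by rewrite nrm_gt0.
have := @opN_ball (inc S (N x)^-1 *: x).
rewrite linearZ /= !nrmZ_inc ger0_norm ?invr_ge0 ?nrm_ge0 // mulVf ?gt_eqF //.
by move=> /(_ (lexx _)); rewrite ler_pdivrMl // mulrC.
Qed.

Lemma opN_approx e : 0 < e -> exists2 x, N x <= 1 & opN f - e < N (f x).
Proof.
move=> e0; apply: contrapT => /forall2NP nox.
suff : opN f <= opN f - e by lra.
by apply: opN_lub => x x1; have [//|/negP] := nox x; rewrite -leNgt.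
Qed.

End OpNorm.

Lemma opN1P (X : normedModType K) (f : {linear X -> K^o}) :
  dual_sphere f <-> bounded_map f /\ opN f = 1.
Proof.
rewrite /dual_sphere/= continuous_bounded_map; split=> -[fb f1]; split=> //.
  by rewrite /opN f1 rp1.
by rewrite opnorm_inc // f1 rmorph1.
Qed.

(** A real functional g below the norm with g x0 = |x0| is the real part of
    F x = g x - i g (i x).  Rotating F x to the positive axis shows that F
    inherits the bound of g, and F x0 is real since its real part is already as
    large as its modulus may be. *)
Lemma norming_functional (X : normedModType K) (x0 : X) : x0 != 0 ->
  exists2 f : {linear X -> K^o}, dual_sphere f & f x0 = inc S (N x0).
Proof.
move=> x00.
have sN : sublinear S (fun x : X => N x).
  by split=> [x y|t x t0]; [exact: nrmD|rewrite nrmZ_inc ger0_norm].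
have [g [[_ gZ0] gD gN gx0]] := hahn_banach x0 sN.
have g0 : g 0 = 0 by have := gD 0 0; rewrite addr0; lra.
have gNeg x : g (- x) = - g x by have := gD x (- x); rewrite subrr g0; lra.
have gZ t x : g (inc S t *: x) = t * g x.
  have [t0|t0] := leP 0 t; first exact: gZ0.
  rewrite -[t]opprK rmorphN scaleNr gNeg gZ0 ?mulNr //; lra.
pose F (x : X) : K := inc S (g x) - im_unit S * inc S (g (im_unit S *: x)).
have rF x : rp S (F x) = g x.
  by rewrite raddfB /= rp_inc mulrC rp_incM rp_im_unit mulr0 subr0.
have FD x y : F (x + y) = F x + F y.
  by rewrite /F scalerDr !gD !rmorphD mulrDr opprD addrACA.
have Finc t x : F (inc S t *: x) = inc S t * F x.
  by rewrite /F scalerA [im_unit S * inc S t]mulrC -scalerA !gZ !rmorphM mulrBr mulrCA.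
have Fim x : F (im_unit S *: x) = im_unit S * F x.
  rewrite /F scalerA; case: (im_unit_cases S) => [->|jj2].
    by rewrite !mul0r !scale0r g0 rmorph0 subr0.
  by rewrite mulrBr mulrA jj2 scaleN1r gNeg rmorphN mulrN mulN1r !opprK addrC.
have Fl : linear (F : X -> K^o).
  move=> k x y; rewrite FD; congr (_ + _).
  rewrite {1}(re_im_split S k) scalerBl -scaleN1r.
  have -> : -1 = inc S (-1) by rewrite rmorphN rmorph1.
  rewrite FD !Finc -scalerA Fim Finc rmorphN rmorph1 mulN1r [X in X *: F x](re_im_split S k).
  by rewrite scalerBl /GRing.scale/= mulrA.
have [f fF] := pack_linear Fl.
have FN x : N (F x) <= N x.
  have [t t1 tF] := exists_phase S (F x).
  have : rp S (t * F x) <= N x.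
    have -> : t * F x = F (t *: x) by rewrite -fF linearZ.
    by rewrite rF -(nrmZ_unit S x t1); exact: gN.
  by rewrite tF rp_inc.
have Fx0 : F x0 = inc S (N x0).
  have Nx0 : N (F x0) = N x0.
    by apply/eqP; rewrite eq_le FN -gx0 -rF rp_le_nrm.
  by rewrite -Nx0; apply: rp_eq_nrm; rewrite rF gx0 Nx0.
have fb : bounded_map f by exists 1 => x; rewrite fF mul1r; exact: FN.
exists f; last by rewrite fF.
apply/opN1P; split => //; apply/eqP; rewrite eq_le; apply/andP; split.
  apply: opN_lub => // x; apply: le_trans; rewrite fF; exact: FN.
have := opN_le fb x0; rewrite fF Fx0 nrm_inc ger0_norm ?nrm_ge0 //.
by rewrite -{1}[N x0]mul1r ler_pM2r // nrm_gt0.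
Qed.

End BoundedMap.

(** * Numerical radius; lush spaces have numerical index one *)

Section NumericalRadius.
Context (R : realType) (K : numFieldType) (S : real_form R K) (X : normedModType K).
Local Notation N := (nrm S).

Lemma functionalZ (f : {linear X -> K^o}) k x : f (k *: x) = k * f x.
Proof. exact: linearZ. Qed.

Lemma dual_sphere_le (f : {linear X -> K^o}) x : dual_sphere f -> N (f x) <= N x.
Proof. by move=> /(opN1P S)[fb f1]; have := opN_le fb x; rewrite f1 mul1r. Qed.

Lemma nrm_normalize (x : X) : x != 0 -> N (inc S (N x)^-1 *: x) = 1.
Proof.
by move=> x0; rewrite nrmZ_inc ger0_norm ?invr_ge0 ?nrm_ge0 // mulVf // nrm_eq0.
Qed.

Context (T : {linear X -> X}) (Tb : bounded_map S T).
Local Notation tau := (opN S T).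

Lemma numerical_radiusP : (exists x : X, x != 0) ->
  exists nu, [/\ numerical_radius T = inc S nu, 0 <= nu,
    (forall x (f : {linear X -> K^o}), N x = 1 -> dual_sphere f -> f x = 1 ->
      N (f (T x)) <= nu) &
    (forall m, (forall x (f : {linear X -> K^o}), N x = 1 -> dual_sphere f -> f x = 1 ->
      N (f (T x)) <= m) -> nu <= m)].
Proof.
move=> [x0 x00].
pose A := [set r : K | exists (x : X) (f : {linear X -> K^o}),
    [/\ unit_sphere x, dual_sphere f, f x = 1 & r = `|f (T x)|]].
have [||_ [x [f [/(unit_sphereE S) x1 f1 fx ->]]]|supE ubf lubf] :=
    @supremum_inc R K S A tau.
- have [f f1 fx] := norming_functional S x00.
  pose x := inc S (N x0)^-1 *: x0.
  exists `|f (T x)|, x, f; split=> //; first by apply/(unit_sphereE S); exact: nrm_normalize.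
  by rewrite functionalZ fx -rmorphM mulVf ?rmorph1 // nrm_eq0.
- by move=> _ [x [f [_ _ _ ->]]].
- apply: le_trans (dual_sphere_le _ f1) _.
  by have := opN_le Tb x; rewrite x1 mulr1.
have ub x (f : {linear X -> K^o}) : N x = 1 -> dual_sphere f -> f x = 1 ->
    N (f (T x)) <= sup [set rp S a | a in A].
  by move=> x1 f1 fx; apply: ubf; exists x, f; split=> //; apply/(unit_sphereE S).
exists (sup [set rp S a | a in A]); split=> //.
  have [f f1 fx] := norming_functional S x00.
  pose x := inc S (N x0)^-1 *: x0.
  apply: le_trans (nrm_ge0 S (f (T x))) (ub _ _ _ _ _) => //; first exact: nrm_normalize.
  by rewrite functionalZ fx -rmorphM mulVf ?rmorph1 // nrm_eq0.
move=> m mA; apply: lubf => _ [x [f [/(unit_sphereE S) x1 f1 fx ->]]]; exact: mA.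
Qed.

(** A functional norming u shows that Id - kT shrinks norms by a factor of at
    least 1 - |k| nu.  Apply this to u = x + kTx, for which
    u - kTu = x - k^2 TTx differs from x in second order only. *)
Lemma lumer nu k x :
  (forall x (f : {linear X -> K^o}), N x = 1 -> dual_sphere f -> f x = 1 ->
      N (f (T x)) <= nu) ->
  (1 - N k * nu) * N (x + k *: T x) <= (1 + (N k * tau) ^+ 2) * N x.
Proof.
move=> Tnu.
have below u : (1 - N k * nu) * N u <= N (u - k *: T u).
  have [->|u0] := eqVneq u 0; first by rewrite linear0 scaler0 subr0 nrm0 mulr0.
  have [f f1 fu] := norming_functional S u0.
  have Nu0 : 0 < N u by rewrite nrm_gt0.
  have fTu : N (f (T u)) <= nu * N u.
    have := Tnu (inc S (N u)^-1 *: u) f (nrm_normalize u0) f1.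
    rewrite [T _]linearZ /= !functionalZ nrmM nrm_inc fu -rmorphM mulVf ?gt_eqF // rmorph1.
    move=> /(_ erefl); rewrite ger0_norm ?invr_ge0 ?nrm_ge0 //.
    by rewrite mulrC ler_pdivrMr.
  apply: le_trans (dual_sphere_le (u - k *: T u) f1).
  apply: le_trans (rp_le_nrm S _).
  rewrite linearB functionalZ fu raddfB /= rp_inc.
  have := rp_le_nrm S (k * f (T u)); rewrite nrmM.
  have := ler_wpM2l (nrm_ge0 S k) fTu; rewrite /GRing.scale/=. lra.
apply: le_trans (below _) _.
rewrite [T (_ + _)]linearD [T (_ *: _)]linearZ /= scalerDr opprD addrA addrK scalerA.
apply: (le_trans (nrmB _ _ _)); rewrite mulrDl mul1r lerD2l nrmZ nrmM.
have := ler_wpM2l (opN_ge0 Tb) (opN_le Tb x); have := opN_le Tb (T x).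
have := nrm_ge0 S k => k0 /le_trans h /h{}h.
have := ler_wpM2l (mulr_ge0 k0 k0) h; lra.
Qed.

End NumericalRadius.

Section LushIndex.
Context (R : realType) (K : numFieldType) (S : real_form R K) (X : normedModType K).
Local Notation N := (nrm S).

Lemma closure_approx (z : X) (A : set X) (e : R) : closure A z -> 0 < e ->
  exists2 w, A w & N (z - w) < e.
Proof.
move=> clz e0; have [|w [Aw zw]] := clz (ball z (inc S e)).
  by apply: nbhsx_ballx; rewrite -(rmorph0 (inc S)) inc_lt.
by exists w => //; move: zw; rewrite nrm_lt_inc -ball_normE.
Qed.

(** Sublevel sets of [fun z => N (h z)] are closed and convex, so that a bound
    on h over the unit multiples of a set passes to its closed absolutely convex
    hull. *)
Lemma closed_sublevel (Y : normedModType K) (h : {linear X -> Y}) (M : R) :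
  bounded_map S h -> closed [set z | N (h z) <= M].
Proof.
move=> hb z clz /=; apply/ler_addgt0Pr => e e0.
have d0 : 0 < e / (1 + opN S h).
  by apply: divr_gt0 => //; have := opN_ge0 hb; lra.
have [w /= wM zw] := closure_approx clz d0.
have := nrm_dist_le S (h z) (h w); rewrite -linearB /=.
have := opN_le hb (z - w); have := opN_ge0 hb => h0.
have : opN S h * N (z - w) <= e.
  move: zw; rewrite ltr_pdivlMr; last lra.
  have := nrm_ge0 S (z - w); nra.
lra.
Qed.

Lemma i01_inc (l : {i01 K}) : exists a : R, [/\ 0 <= a, a <= 1 & l%:num = inc S a].
Proof.
have l0 : 0 <= l%:num :> K by exact: ge0.
have l1 : l%:num <= 1 :> K by exact: le1.
exists (rp S l%:num); rewrite inc_rp_ge0 //; split=> //.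
  by rewrite -(inc_le S) rmorph0 inc_rp_ge0.
by rewrite -(inc_le S) inc_rp_ge0 // (rmorph1 (inc S)).
Qed.

Lemma convex_sublevel (Y : normedModType K) (h : {linear X -> Y}) (M : R) :
  convex_set ([set z | N (h z) <= M] : set X).
Proof.
move=> x y l; rewrite !inE /= => hx hy.
have -> : conv l x y = l%:num *: (x : X) + (1 - l%:num) *: (y : X) :> X by [].
have [a [a0 a1 ->]] := i01_inc l.
rewrite -[1](rmorph1 (inc S)) -rmorphB linearD !linearZ /=.
apply: le_trans (nrmD _ _ _) _; rewrite !nrmZ_inc !ger0_norm ?subr_ge0 //.
have h1 := ler_wpM2l a0 hx; have h2 : (1 - a) * N (h y) <= (1 - a) * M.
  by apply: ler_wpM2l => //; rewrite subr_ge0.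
lra.
Qed.

Lemma sub_closed_aconv (A C : set X) : closed C -> convex_set C ->
  (forall t z, unit_scalars t -> A z -> C (t *: z)) -> closed_aconv A `<=` C.
Proof.
move=> cC vC AC; apply: smallest_sub; first by split.
by move=> _ [t t1 [z Az <-]]; exact: AC.
Qed.

Lemma closed_aconv_mem (A : set X) t z : unit_scalars t -> A z -> closed_aconv A (t *: z).
Proof. by move=> t1 Az; apply: sub_gen_smallest; exists t => //; exists z. Qed.

(** If nu < |T|, lushness (the claim [key]) produces f and z with f(z) and
    |f(Tz)| nearly maximal.  Then |z + kTz| is at least about 1 + |k| |T|,
    whereas Lumer's estimate allows about 1 + |k| nu, a contradiction for small
    k. *)
Lemma lush_numerical_index_one (re : K -> K) : (forall k, re k = inc S (rp S k)) ->
  lush re X -> numerical_index_one X.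
Proof.
move=> reE lushX T /(continuous_bounded_map S) Tb; rewrite (opnorm_inc Tb).
have [X0|/existsNP[x0 /eqP x00]] := pselect (forall x : X, x = 0).
  have -> : opN S T = 0.
    apply/eqP; rewrite eq_le (opN_ge0 Tb) andbT; apply: (opN_lub Tb) => x _.
    by rewrite (X0 x) linear0 nrm0.
  rewrite rmorph0 /numerical_radius [X in supremum _ X](_ : _ = set0) ?supremum0 //.
  rewrite -subset0 => r [x [f [/(unit_sphereE S) + _ _ _]]].
  by rewrite (X0 x) nrm0 => /esym/eqP; rewrite oner_eq0.
have [nu [-> nu0 Tnu nulub]] := numerical_radiusP Tb (ex_intro _ x0 x00).
congr (inc S _); apply/eqP; rewrite eq_le; apply/andP; split.
  apply: nulub => x f x1 f1 fx; apply: le_trans (dual_sphere_le _ _ f1) _.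
  by have := opN_le Tb x; rewrite x1 mulr1.
rewrite leNgt; apply/negP => nutau.
set tau := opN S T in nutau *.
have tau0 : 0 < tau by apply: le_lt_trans nutau.
(* The loss is linear in d: d from the choice of x, tau * d from the slice
   condition at y1, and tau * d from the distance of x1 to the hull; one more d
   leaves room for a strict inequality. *)
have key d : 0 < d -> d < tau -> exists (f : {linear X -> K^o}) z,
    [/\ dual_sphere f, N z <= 1, 1 - d < rp S (f z) &
      tau - (2 * tau + 2) * d < N (f (T z))].
  move=> d0 dtau; have [x xB xd] := opN_approx Tb d0.
  have NTx0 : 0 < N (T x) by apply: le_lt_trans xd; rewrite subr_ge0 ltW.
  have x_neq0 : x != 0 by apply: contraTneq NTx0 => ->; rewrite linear0 nrm0 ltxx.
  have Nx0 : 0 < N x by rewrite nrm_gt0.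
  pose x1 := inc S (N x)^-1 *: x.
  have Nx1 : N x1 = 1 by exact: nrm_normalize.
  have Tx1d : tau - d < N (T x1).
    apply: (lt_le_trans xd); rewrite linearZ /= nrmZ_inc ger0_norm ?invr_ge0 ?nrm_ge0 //.
    by rewrite ler_peMl ?nrm_ge0 // invf_ge1.
  have NTx1 : 0 < N (T x1) by apply: le_lt_trans Tx1d; rewrite subr_ge0 ltW.
  have Tx1_neq0 : T x1 != 0 by rewrite -(nrm_gt0 S).
  pose y1 := inc S (N (T x1))^-1 *: T x1.
  have Ny1 : N y1 = 1 by exact: nrm_normalize.
  have incd0 : 0 < inc S d by rewrite -(rmorph0 (inc S)) inc_lt.
  have [f [f1 y1f]] := lushX y1 x1 (proj2 (unit_sphereE S _) Ny1)
    (proj2 (unit_sphereE S _) Nx1) _ incd0.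
  rewrite dist_ltP; last first.
    exists (1 *: y1); apply: closed_aconv_mem y1f; exact: normr1.
  move=> [w wA x1w].
  apply: contrapT => nokey.
  have fb : bounded_map S f by have [] := proj1 (opN1P S f) f1.
  have fTb : bounded_map S (f \o T).
    exists tau => z /=; apply: le_trans (dual_sphere_le S _ f1) _; exact: (opN_le Tb).
  have : N (f (T w)) <= tau - (2 * tau + 2) * d.
    apply: (@sub_closed_aconv _ [set z | N ((f \o T) z) <= tau - (2 * tau + 2) * d]) wA.
    - exact: closed_sublevel.
    - exact: convex_sublevel.
    move=> t z t1 [zB zs] /=; rewrite [T _]linearZ /= functionalZ nrmM unit_nrm //.
    rewrite mul1r leNgt; apply/negP => zT.
    apply: nokey; exists f, z; split=> //; first exact/(unit_ballE S).
    by move: zs; rewrite reE -[1](rmorph1 (inc S)) -rmorphB inc_lt.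
  have : N (f (T x1)) - N (f (T w)) <= tau * d.
    apply: le_trans (nrm_dist_le S _ _) _; rewrite -!linearB /=.
    apply: le_trans (dual_sphere_le S _ f1) _.
    by apply: le_trans (opN_le Tb _) _; rewrite ler_wpM2l // ltW.
  have : (1 - d) * N (T x1) <= N (f (T x1)).
    have -> : T x1 = inc S (N (T x1)) *: y1.
      by rewrite scalerA -rmorphM divff ?gt_eqF // rmorph1 scale1r.
    rewrite functionalZ nrmM nrmZ_inc Ny1 mulr1 nrm_inc !ger0_norm ?(ltW NTx1) //.
    rewrite mulrC ler_wpM2l ?(ltW NTx1) //.
    apply: le_trans (rp_le_nrm S _); apply: ltW.
    by case: y1f => _; rewrite reE -[1](rmorph1 (inc S)) -rmorphB inc_lt.
  have [d1|d1] := leP d 1; last first.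
    have := nrm_ge0 S (f (T w)); nra.
  have : (1 - d) * (tau - d) <= (1 - d) * N (T x1).
    by apply: ler_wpM2l; rewrite ?subr_ge0 // ltW.
  have : 0 < d * tau by apply: mulr_gt0.
  have : 0 < d * d by apply: mulr_gt0.
  lra.
(* D bounds the coefficient of t ^+ 2 in the final comparison, so that t is
   chosen to make the first-order gain t * (tau - nu) twice as large as the
   second-order error; d is then taken of second order in t. *)
pose D := tau ^+ 2 + 1 + tau * nu.
have D0 : 1 <= D.
  have := mulr_ge0 (ltW tau0) nu0; have := sqr_ge0 tau; rewrite /D; lra.
pose t := (tau - nu) / (2 * D).
have t0 : 0 < t by apply: divr_gt0; lra.
have tD : 2 * (t * D) = tau - nu by rewrite /t; field; lra.
have tnu : t * nu <= 1.
  have : t * nu * (2 * D) = (tau - nu) * nu by rewrite /t; field; lra.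
  have := mulr_ge0 nu0 nu0; have := sqr_ge0 tau; have := mulr_ge0 (ltW tau0) nu0.
  rewrite leNgt => ? ? ? ?; apply/negP => tnu1.
  have : 0 < (t * nu - 1) * (2 * D) by apply: mulr_gt0; lra.
  have DE : D = tau ^+ 2 + 1 + tau * nu by []; lra.
pose c := 2 * tau + 2.
pose e := t ^+ 2 / (1 + t * c).
have c0 : 0 < 1 + t * c by rewrite /c; nra.
have e0 : 0 < e by apply: divr_gt0 => //; exact: exprn_gt0.
have tau2 : 0 < tau / 2 by lra.
have [d [d0 dtau de]] : exists d, [/\ 0 < d, d < tau & d * (1 + t * c) <= t ^+ 2].
  exists (Num.min e (tau / 2)); split.
  - by rewrite lt_min e0.
  - by rewrite gt_min; apply/orP; right; lra.
  - by rewrite -ler_pdivlMr // ge_min lexx.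
have [f [z [f1 z1 fz fTz]]] := key d d0 dtau.
have [s s1 sf] := exists_phase S (f (T z)).
have := lumer Tb (inc S t * s) z Tnu.
rewrite nrmM nrm_inc unit_nrm // mulr1 ger0_norm ?(ltW t0) // -/tau.
have zk : 1 - d + t * (tau - c * d) <= N (z + (inc S t * s) *: T z).
  apply: le_trans (dual_sphere_le S _ f1); apply: le_trans (rp_le_nrm S _).
  have fsT : f ((inc S t * s) *: T z) = inc S t * inc S (N (f (T z))).
    by rewrite functionalZ -mulrA sf.
  rewrite linearD raddfD /= fsT rp_incM rp_inc.
  have := ler_wpM2l (ltW t0) (ltW fTz); rewrite -/c; lra.
have h : 1 + t * tau - t ^+ 2 <= N (z + (inc S t * s) *: T z).
  by move: zk de; lra.
have h2 : (1 - t * nu) * (1 + t * tau - t ^+ 2) <= (1 - t * nu) * N (z + (inc S t * s) *: T z).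
  by apply: ler_wpM2l => //; rewrite subr_ge0.
have h3 : (1 + (t * tau) ^+ 2) * N z <= 1 + (t * tau) ^+ 2.
  by rewrite ler_piMr // addr_ge0 // sqr_ge0.
move=> h4; have h5 := le_trans h2 (le_trans h4 h3).
have h6 : t * (tau - nu) <= t * (t * D).
  have : 0 <= t ^+ 2 * (t * nu) by apply: mulr_ge0; [exact: sqr_ge0|exact: mulr_ge0 (ltW t0) nu0].
  rewrite /D; lra.
have := ler_pM2l t0 (tau - nu) (t * D); rewrite h6 => /esym; lra.
Qed.

End LushIndex.

(** * Numerical index one implies the alternative Daugavet property *)

Section IndexADP.
Context (R : realType) (K : numFieldType) (S : real_form R K).
Local Notation N := (nrm S).

Lemma lipschitz_pair_continuous (G : R * R -> R) (C : R) :
  (forall p q, G p - G q <= C * (`|p.1 - q.1| + `|p.2 - q.2|)) -> continuous G.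
Proof.
move=> Glip p; apply/cvgrPdist_lt => e e0.
pose M := Num.max C 0 + 1.
have M0 : 0 < M by rewrite /M ltr_pwDr // le_max lexx orbT.
have CM : C <= M by rewrite /M ler_wpDr // le_max lexx.
have d0 : 0 < e / (2 * M) by apply: divr_gt0 => //; lra.
have : nbhs p (ball p (e / (2 * M))) by exact: nbhsx_ballx.
apply: filterS => q [].
rewrite /ball/= /ball_ => p1 p2.
have GM u v : G u - G v <= M * (`|u.1 - v.1| + `|u.2 - v.2|).
  by apply: le_trans (Glip u v) _; apply: ler_wpM2r CM; rewrite addr_ge0.
have : M * (`|p.1 - q.1| + `|p.2 - q.2|) < e.
  have -> : e = M * (e / (2 * M) + e / (2 * M)) by field; lra.
  by rewrite ltr_pM2l // ltrD.
have := GM p q; have := GM q p; rewrite [`|q.1 - p.1|]distrC [`|q.2 - p.2|]distrC ltr_norml; lra.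
Qed.

(** The unit circle of K is the image of a compact subset of the square under
    (p1, p2) |-> p1 - i p2; for real scalars every p2 is allowed, but the image
    is still {1, -1}. *)
Lemma unit_circle_max (F : K -> R) (C : R) :
  (forall s t, F s - F t <= C * N (s - t)) ->
  exists2 t, unit_scalars t & forall s, unit_scalars s -> F s <= F t.
Proof.
move=> Flip.
pose phi (p : R * R) : K := inc S p.1 - im_unit S * inc S p.2.
have phiN p q : N (phi p - phi q) <= `|p.1 - q.1| + `|p.2 - q.2|.
  have -> : phi p - phi q = inc S (p.1 - q.1) - im_unit S * inc S (p.2 - q.2).
    by rewrite /phi !rmorphB; ring.
  apply: le_trans (nrmB _ _ _) _; rewrite nrmM !nrm_inc lerD2l.
  by rewrite ler_piMl // nrm_im_unit.
have Npsi p q : N (phi p) - N (phi q) <= 1 * (`|p.1 - q.1| + `|p.2 - q.2|).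
  by rewrite mul1r; apply: le_trans (phiN p q); exact: nrm_dist_le.
have Cge0 : 0 <= C.
  by have := Flip 1 0; have := Flip 0 1; rewrite subr0 sub0r nrmN nrm1; lra.
have Fpsi p q : F (phi p) - F (phi q) <= C * (`|p.1 - q.1| + `|p.2 - q.2|).
  by apply: le_trans (Flip _ _) _; apply: ler_wpM2l.
pose A := (`[(-1 : R), 1]%classic `*` `[(-1 : R), 1]%classic) `&`
  ((fun p => N (phi p)) @^-1` [set 1]).
have cptA : compact A.
  apply: compact_closedI; first by apply: compact_setX; exact: segment_compact.
  apply: closed_comp => [p _|]; last exact: closed_eq.
  exact: lipschitz_pair_continuous Npsi p.
have phiA s : unit_scalars s -> exists2 p, A p & phi p = s.
  move=> s1; exists (rp S s, rp S (im_unit S * s)); last by rewrite /phi -re_im_split.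
  split; last by rewrite /= /phi -re_im_split unit_nrm.
  split; rewrite /= in_itv /= -ler_norml; apply: le_trans (norm_rp_le S _) _.
    by rewrite unit_nrm.
  by rewrite nrmM (unit_nrm S s1) mulr1 nrm_im_unit.
have A0 : A !=set0 by have [p Ap _] := phiA 1 (normr1 K); exists p.
have [] := @compact_EVT_max _ R (F \o phi) A A0 cptA.
  by apply: continuous_subspaceT; exact: lipschitz_pair_continuous Fpsi.
move=> p /set_mem [_ /= phi1] pmax; exists (phi p).
  by apply/eqP; rewrite -[X in _ == X](rmorph1 (inc S)) -nrm_eq_inc phi1.
by move=> s /phiA[q Aq <-]; apply: pmax; exact/mem_set.
Qed.

(** Pairs (x, f) with f(x) = 1 almost attaining the numerical radius give
    |x + tTx| >= 1 + |f(Tx)| for the phase t of f(Tx); the maximum over the unit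
    circle therefore reaches 1 + |T|. *)
Lemma numerical_index_one_ADP (X : normedModType K) :
  numerical_index_one X -> alternative_Daugavet X.
Proof.
move=> n1 T Tc [v v0 _].
have Tb := proj1 (continuous_bounded_map S T) Tc.
have [nu [nuE nu0 Tnu nulub]] := numerical_radiusP Tb (ex_intro _ v v0).
have {nuE} nuE : nu = opN S T.
  by apply: (can_inj (rp_inc S)); rewrite -nuE -(opnorm_inc Tb); exact: n1.
pose G t (x : X) := x + t *: T x.
have Gb t x : N x <= 1 -> N (G t x) <= 1 + N t * opN S T.
  move=> x1; apply: le_trans (nrmD _ _ _) _; rewrite lerD // nrmZ ler_wpM2l ?nrm_ge0 //.
  exact: opN_ball.
pose F t := opN S (G t).
have FE t : opnorm (G t) = inc S (F t) by have [] := opnormP (Gb t).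
have Fub t x : N x <= 1 -> N (G t x) <= F t by have [_ + _] := opnormP (Gb t); apply.
have Flub t m : (forall x, N x <= 1 -> N (G t x) <= m) -> F t <= m.
  by have [_ _ +] := opnormP (Gb t); apply.
have Flip s t : F s - F t <= opN S T * N (s - t).
  rewrite lerBlDr; apply: Flub => x x1.
  have -> : G s x = (s - t) *: T x + G t x.
    by rewrite /G scalerBl addrCA addrC subrK addrC.
  apply: le_trans (nrmD _ _ _) _; apply: lerD; last exact: Fub.
  by rewrite nrmZ mulrC ler_wpM2r ?nrm_ge0 // opN_ball.
have [t t1 tmax] := unit_circle_max Flip.
have Fle s : unit_scalars s -> F s <= 1 + opN S T.
  by move=> s1; apply: Flub => x x1; apply: le_trans (Gb s x x1) _; rewrite unit_nrm // mul1r.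
have FtE : F t = 1 + opN S T.
  apply/eqP; rewrite eq_le Fle //= -lerBrDl -nuE; apply: nulub => x f x1 f1 fx.
  have [s s1 sf] := exists_phase S (f (T x)).
  rewrite lerBrDl; apply: le_trans (tmax s s1).
  apply: le_trans (Fub s x _); last by rewrite x1.
  apply: le_trans (dual_sphere_le S _ f1); apply: le_trans (rp_le_nrm S _).
  by rewrite /G linearD functionalZ fx sf raddfD /= rp1 rp_inc.
rewrite (opnorm_inc Tb) -[1](rmorph1 (inc S)) -rmorphD; split.
  by exists t => //; rewrite -FtE -FE.
by move=> _ [s s1 <-]; rewrite -/(G s) FE inc_le Fle.
Qed.

End IndexADP.

(** * Prescribing averages of adversarial points of slices *)

Section Game.
Context (R : realType) (K : numFieldType) (S : real_form R K) (X : normedModType K).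
Local Notation N := (nrm S).

Lemma convex_set_inc (A : set X) a x y : convex_set A -> 0 <= a -> a <= 1 ->
  A x -> A y -> A (inc S a *: x + inc S (1 - a) *: y).
Proof.
move=> cA a0 a1 Ax Ay.
have i0 : 0 <= inc S a by rewrite -(rmorph0 (inc S)) inc_le.
have i1 : inc S a <= 1 by rewrite -[leRHS](rmorph1 (inc S)) inc_le.
have := cA x y (Itv01 i0 i1) (mem_set Ax) (mem_set Ay).
by rewrite inE rmorphB rmorph1.
Qed.

Fixpoint sumset (A : set X) (j : nat) : set X :=
  if j is j'.+1 then [set s + p | s in sumset A j' & p in A] else [set 0].

Lemma sumsetS (A B : set X) j : A `<=` B -> sumset A j `<=` sumset B j.
Proof.
move=> AB; elim: j => [//|j IH] _ [s /IH As [p /AB Bp <-]]; exists s => //; exists p => //.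
Qed.

Lemma sumset_mean (A : set X) j s : convex_set A -> sumset A j.+1 s ->
  A (inc S j.+1%:R^-1 *: s).
Proof.
move=> cA; elim: j s => [|j IH] s.
  by case=> _ -> [p Ap <-]; rewrite add0r invr1 rmorph1 scale1r.
case=> {}s /IH As [p Ap <-].
have j2 : (j.+2%:R : R) != 0 by rewrite pnatr_eq0.
have := convex_set_inc (a := j.+1%:R / j.+2%:R) cA _ _ As Ap.
rewrite scalerA -rmorphM mulrAC divff ?pnatr_eq0 // mul1r.
have -> : 1 - j.+1%:R / j.+2%:R = j.+2%:R^-1 :> R.
  by apply: (mulIf j2); rewrite mulrBl divfK // mulVf // mul1r -natrB // subSnn.
rewrite -scalerDr; apply; first by rewrite divr_ge0.
by rewrite ler_pdivrMr // mul1r ler_nat.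
Qed.

(** F stands for the positions of a game, each recorded as the convex hull of
    the points obtained so far: whenever a functional f and d > 0 are proposed,
    the position can be enlarged by a point z at which f is within d of its
    supremum over the ball.  Nothing else is known about z. *)
Definition forcing (F : set (set X)) :=
  (forall A, F A -> convex_set A /\ (forall z, A z -> N z <= 1)) /\
  (forall A (f : {linear X -> K^o}) d, F A -> bounded_map S f -> 0 < d ->
    exists A', [/\ F A', A `<=` A' &
      exists2 z, A' z & forall b, N b <= 1 -> rp S (f b) <= rp S (f z) + d]).

Section Coordinates.
Variables (F : set (set X)) (Ff : forcing F).
Variables (a : nat -> {linear X -> K^o}) (ab : forall k, bounded_map S (a k)).

(** A Hilbertian substitute for the norm on the span of the first m basis
    vectors. *)
Let D m v := \sum_(k < m) N (a k v) ^+ 2.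

Let D_bounded m : exists2 D0, 0 <= D0 & forall v, N v <= 2 -> D m v <= D0.
Proof.
exists (\sum_(k < m) (opN S (a k) * 2) ^+ 2).
  by apply: sumr_ge0 => k _; exact: sqr_ge0.
move=> v v2; apply: ler_sum => k _; have h0 := opN_ge0 (ab k).
rewrite ler_pXn2r ?nnegrE ?nrm_ge0 ?mulr_ge0 //.
by apply: le_trans (opN_le (ab k) v) _; rewrite ler_wpM2l.
Qed.

Let D_coord m v k : (k < m)%N -> N (a k v) ^+ 2 <= D m v.
Proof.
move=> km; rewrite /D (bigD1 (Ordinal km)) //= lerDl.
by apply: sumr_ge0 => i _; exact: sqr_ge0.
Qed.

(** The cross term of the quadratic form is the real part of a functional, so
    it can be proposed as a move of the game. *)
Let D_add m u : exists2 f : {linear X -> K^o}, bounded_map S f &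
  forall v, D m (u + v) = D m u + 2 * rp S (f v) + D m v.
Proof.
pose c k : K := inc S (rp S (a k u)) + inc S (rp S (im_unit S * a k u)) * im_unit S.
have fl : linear ((fun v => \sum_(k < m) c k * a k v) : X -> K^o).
  move=> t x y; rewrite /= scaler_sumr -big_split /=; apply: eq_bigr => k _.
  by rewrite linearD functionalZ mulrDr mulrCA.
have [f fE] := pack_linear fl; exists f.
  exists (\sum_(k < m) N (c k) * opN S (a k)) => v.
  rewrite fE mulr_suml; elim/big_ind2: _ => [|x x' y y' xx yy|k _].
  - by rewrite nrm0.
  - by apply: le_trans (nrmD _ _ _) _; exact: lerD.
  - by rewrite nrmM -mulrA ler_wpM2l ?nrm_ge0 // opN_le.
move=> v; rewrite fE raddf_sum /= mulr_sumr -!big_split /=; apply: eq_bigr => k _.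
have -> : rp S (c k * a k v) =
    rp S (a k u) * rp S (a k v) + rp S (im_unit S * a k u) * rp S (im_unit S * a k v).
  by rewrite /c mulrDl raddfD /= -mulrA !rp_incM.
have -> : a k (u + v) = a k u + a k v by exact: linearD.
rewrite !(sqr_nrm S) mulrDr !raddfD /=; ring.
Qed.

(** A Frank-Wolfe iteration.  If s is the sum of j points obtained so far, ask
    for a point z nearly maximizing the functional v |-> <j b - s, v>.  As b
    belongs to the ball, <j b - s, b - z> is at most a small constant, so that
    D (j b - s) grows at most linearly in j; after division by j ^+ 2 the mean
    of the points has coordinates close to those of b. *)
Lemma force_coordinates m A b eta : F A -> N b <= 1 -> 0 < eta ->
  exists A', [/\ F A', A `<=` A' &
    exists2 p, A' p & forall k, (k < m)%N -> N (a k (b - p)) < eta].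
Proof.
move=> FA b1 eta0; have [D0 D00 D0P] := D_bounded m.
have step j : exists A', [/\ F A', A `<=` A' &
    exists2 s, sumset A' j s & D m (b *+ j - s) <= j%:R * (D0 + 1)].
  elim: j => [|j [A' [FA' AA' [s As Ds]]]].
    exists A; split=> //; exists 0 => //.
    rewrite mulr0n subr0 mul0r /D big1 // => k _.
    by rewrite linear0 nrm0 expr0n.
  have [f fb fD] := D_add m (b *+ j - s).
  have half0 : 0 < 1 / 2 :> R by lra.
  have [A'' [FA'' A'A'' [z A''z fz]]] := Ff.2 A' f _ FA' fb half0.
  exists A''; split=> //; first exact: subset_trans A'A''.
  exists (s + z); first by exists s; [exact: sumsetS As|exists z].
  rewrite mulrSr opprD addrACA fD linearB raddfB /=.
  have z1 : N z <= 1 by exact: (Ff.1 _ FA'').2.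
  have := D0P (b - z); have := nrmB S b z => bz /(_ _).
  have -> : N (b - z) <= 2 by lra.
  move=> /(_ isT); have := fz b b1; rewrite -[j.+1]addn1 natrD; lra.
pose n := Num.truncn ((D0 + 1) / eta ^+ 2).
have eta2 : 0 < eta ^+ 2 by exact: exprn_gt0.
have nP : D0 + 1 < n.+1%:R * eta ^+ 2.
  rewrite -ltr_pdivrMr //; exact: truncnS_gt.
have [A' [FA' AA' [s As Ds]]] := step n.+1.
exists A'; split=> //; exists (inc S n.+1%:R^-1 *: s).
  by apply: sumset_mean As; exact: (Ff.1 _ FA').1.
move=> k km.
have n0 : 0 < (n.+1%:R : R) by rewrite ltr0n.
have nE : b - inc S n.+1%:R^-1 *: s = inc S n.+1%:R^-1 *: (b *+ n.+1 - s).
  rewrite scalerBr -(scaler_nat _ b) scalerA -(rmorph_nat (inc S)) -rmorphM mulVf ?gt_eqF //.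
  by rewrite rmorph1 scale1r.
rewrite nE functionalZ nrmM nrm_inc ger0_norm ?invr_ge0 ?ler0n // ltr_pdivrMl //.
rewrite -(ltr_pXn2r (n := 2)) ?nnegrE ?nrm_ge0 ?mulr_ge0 ?(ltW eta0) //.
apply: le_lt_trans (D_coord _ km) _; apply: le_lt_trans Ds _.
by rewrite exprMn expr2 -mulrA ltr_pM2l.
Qed.

Variable e : nat -> X.
Definition partial_sum n x : X := \sum_(k < n) a k x *: e k.
Local Notation P := partial_sum.
Hypothesis P_cvg : forall x d, 0 < d -> exists n0, forall n, (n0 <= n)%N -> N (x - P n x) < d.
(** The map x |-> 2 P n x - x changes the sign of all coordinates from n on. *)
Hypothesis P_reflect : forall n x, N (P n x *+ 2 - x) <= N x.
Hypothesis P_P : forall n m x, (n <= m)%N -> P n (P m x) = P n x.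

Let P_sub n x y : P n (x - y) = P n x - P n y.
Proof.
by rewrite /P -sumrB; apply: eq_bigr => k _; rewrite linearB scalerBl.
Qed.

Let P_add n x y : P n (x + y) = P n x + P n y.
Proof.
by rewrite /P -big_split; apply: eq_bigr => k _; rewrite linearD scalerDl.
Qed.

Let P_small m r : 0 < r -> exists2 eta, 0 < eta & forall v,
  (forall k, (k < m)%N -> N (a k v) < eta) -> forall l, (l <= m)%N -> N (P l v) < r.
Proof.
move=> r0; pose M := \sum_(k < m) N (e k).
have M0 : 0 <= M by apply: sumr_ge0 => k _; exact: nrm_ge0.
exists (r / (1 + M)); first by apply: divr_gt0 => //; lra.
move=> v vk l lm; have M1 : 0 < 1 + M by lra.
have -> : r = r / (1 + M) * (1 + M) by rewrite divfK // gt_eqF.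
set eta := r / (1 + M) in vk *.
have eta0 : 0 < eta by apply: divr_gt0.
have : N (P l v) <= eta * \sum_(k < l) N (e k).
  rewrite mulr_sumr /P; elim/big_ind2: _ => [|x x' y y' xx yy|k _].
  - by rewrite nrm0.
  - by apply: le_trans (nrmD _ _ _) _; exact: lerD.
  - by rewrite nrmZ ler_wpM2r ?nrm_ge0 // ltW // vk // (leq_trans (ltn_ord k)).
have lM : \sum_(k < l) N (e k) <= M.
  rewrite /M -!(big_mkord xpredT (fun k => N (e k))) [leRHS](big_cat_nat (n := l)) //=.
  by rewrite lerDl sumr_ge0 // => k _; exact: nrm_ge0.
move=> Pl; apply: (le_lt_trans Pl); rewrite ltr_pM2l //; lra.
Qed.

(** Along the iteration, s is a sum of j points of the position and b is the
    next target, equal to y minus the tail left over so far: up to small errors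
    s + b = (j + 1) y and the first n coordinates of b are those of y.  If p is
    an average of answers whose first m coordinates agree with those of b, its
    remaining coordinates form a new tail, and P n p + P m p - p is the next
    target: it cancels the new tail, keeps the first n coordinates, drops the
    old tail, and lies in the ball as the mean of two reflections of p.  After j
    steps the mean of the points is y up to the error (b - y) / j. *)
Lemma forcing_dense A y eps : F A -> N y <= 1 -> 0 < eps ->
  exists A', [/\ F A', A `<=` A' & exists2 q, A' q & N (y - q) < eps].
Proof.
move=> FA y1 eps0; pose d := eps / 4.
have d0 : 0 < d by rewrite /d; lra.
have [n nP] := P_cvg y d0.
have step j : exists A', [/\ F A', A `<=` A' & exists2 s, sumset A' j s &
    exists b, [/\ N b <= 1, N (P n b - y) < d & N (s + b - y *+ j.+1) <= 3 * d * j%:R]].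
  elim: j => [|j [A' [FA' AA' [s As [b [b1 nb sb]]]]]].
    exists A; split=> //; exists 0 => //; exists y; split=> //.
      by rewrite nrm_distC nP.
    by rewrite add0r mulr1n subrr nrm0 mulr0.
  have [m0 m0P] := P_cvg b d0.
  pose m := maxn n m0.
  have nm : (n <= m)%N by exact: leq_maxl.
  have bm : N (b - P m b) < d by apply: m0P; exact: leq_maxr.
  pose r := Num.min d (d - N (P n b - y)).
  have r0 : 0 < r by rewrite lt_min d0 subr_gt0.
  have rd : r <= d by rewrite ge_min lexx.
  have rd' : r <= d - N (P n b - y) by rewrite ge_min lexx orbT.
  have [eta eta0 etaP] := P_small m r0.
  have [A'' [FA'' A'A'' [p A''p /etaP pb]]] := force_coordinates m FA' b1 eta0.
  have pn := pb n nm; have {pb} pm := pb m (leqnn m).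
  have p1 : N p <= 1 by exact: (Ff.1 _ FA'').2.
  have ny : N (P n p - y) < d.
    have -> : P n p - y = (P n b - y) - P n (b - p).
      by rewrite P_sub opprB [RHS]addrC addrA subrK.
    apply: le_lt_trans (nrmB _ _ _) _; lra.
  exists A''; split=> //; first exact: subset_trans A'A''.
  exists (s + p); first by exists s; [exact: sumsetS As|exists p].
  exists (P n p + P m p - p); split.
  - have -> : P n p + P m p - p =
        inc S 2^-1 *: (P n p *+ 2 - p) + inc S 2^-1 *: (P m p *+ 2 - p).
      rewrite -scalerDr addrACA -mulrnDl -opprD -mulr2n -mulrnBl.
      rewrite -(scaler_nat _ (P n p + P m p - p)) scalerA.
      by rewrite -(rmorph_nat (inc S)) -rmorphM mulVf // rmorph1 scale1r.
    apply: le_trans (nrmD _ _ _) _; rewrite !nrmZ_inc ger0_norm //.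
    have := P_reflect n p; have := P_reflect m p; lra.
  - have -> : P n (P n p + P m p - p) = P n p; last by [].
    by rewrite P_sub P_add !P_P // addrK.
  - have -> : s + p + (P n p + P m p - p) - y *+ j.+2 =
        (s + b - y *+ j.+1) + ((P n p - y) + (P m p - b)).
      rewrite [y *+ j.+2]mulrSr -[s + p + _]addrA (addrC p) subrK.
      rewrite [P n p - y + _]addrACA [s + b - _]addrAC [RHS]addrACA.
      rewrite [b + _]addrC subrK opprD [LHS]addrA; congr (_ - _); exact: addrAC.
    apply: (le_trans (nrmD _ _ _)).
    have := nrmD S (P n p - y) (P m p - b).
    have : N (P m p - b) <= N (P m (b - p)) + N (b - P m b).
      have -> : P m p - b = - (P m (b - p) + (b - P m b)).
        by rewrite P_sub opprD !opprB addrA subrK.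
      by rewrite nrmN; exact: nrmD.
    rewrite -[j.+1%:R]natr1; lra.
pose j := Num.truncn (2 / d).
have jP : 2 < j.+1%:R * d by rewrite -ltr_pdivrMr //; exact: truncnS_gt.
have [A' [FA' AA' [s As [b [b1 nb sb]]]]] := step j.+1.
exists A'; split=> //; exists (inc S j.+1%:R^-1 *: s).
  by apply: sumset_mean As; exact: (Ff.1 _ FA').1.
have j0 : 0 < (j.+1%:R : R) by rewrite ltr0n.
have -> : y - inc S j.+1%:R^-1 *: s = inc S j.+1%:R^-1 *: (y *+ j.+1 - s).
  rewrite scalerBr -(scaler_nat _ y) scalerA -(rmorph_nat (inc S)) -rmorphM mulVf ?gt_eqF //.
  by rewrite rmorph1 scale1r.
rewrite nrmZ_inc ger0_norm ?invr_ge0 ?ler0n // ltr_pdivrMl //.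
have -> : y *+ j.+1 - s = - (s + b - y *+ j.+2) + (b - y).
  rewrite opprB [y *+ j.+2]mulrSr -[b - y]opprB [- (s + b)]opprD.
  by rewrite [X in _ = X - _]addrACA addrK.
apply: (le_lt_trans (nrmD _ _ _)); rewrite nrmN.
have := nrmB S b y; have := sb.
have -> : eps = 4 * d by rewrite /d; lra.
lra.
Qed.

End Coordinates.
End Game.

(** * The alternative Daugavet property as a game *)

Section ADPLush.
Context (R : realType) (K : numFieldType) (S : real_form R K) (X : normedModType K).
Local Notation N := (nrm S).

(** For f = 0 take the direction of u.  Otherwise the property is applied to
    the normalized operator T = f(.)u / (|f| |u|).
    If z almost attains |Id + tT| = 2, both |z| and |f(z)| / |f| are nearly 1,
    so that a rotation of z almost maximizes f while t f(z) u / (|f| |u|) is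
    nearly a unit multiple of u / |u|; hence u / |u| and a unit multiple of z
    add up to norm nearly 2.  By the triangle inequality the same holds for u
    itself, with |u| + 1 in place of 2. *)
Lemma ADP_extend (f : {linear X -> K^o}) (u : X) (d : R) :
  alternative_Daugavet X -> bounded_map S f -> u != 0 -> 0 < d ->
  exists (z : X) (t : K), [/\ N z <= 1, unit_scalars t,
    (forall b, N b <= 1 -> rp S (f b) <= rp S (f z) + d) &
    N u + 1 - d < N (u + t *: z)].
Proof.
move=> adp fb u0 d0.
pose mu := N u; have mu0 : 0 < mu by rewrite /mu nrm_gt0.
pose u1 := inc S mu^-1 *: u.
have Nu1 : N u1 = 1 by exact: nrm_normalize.
have uE : u = inc S mu *: u1.
  by rewrite scalerA -rmorphM divff ?gt_eqF // rmorph1 scale1r.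
clearbody u1.
pose phi := opN S f.
have fphi b : N b <= 1 -> rp S (f b) <= phi.
  by move=> b1; apply: le_trans (rp_le_nrm S _) _; exact: opN_ball.
have := opN_ge0 fb; rewrite -/phi le_eqVlt => /predU1P[phi0|phi0].
  exists u1, 1; rewrite Nu1; split=> //; first exact: normr1.
    move=> b /fphi; rewrite -phi0 => /le_trans; apply.
    have := opN_ball fb (x := u1); rewrite Nu1 -/phi -phi0 => /(_ (lexx _)) Nf.
    have := norm_rp_le S (f u1) => h; have := le_trans h Nf.
    by rewrite normr_le0 => /eqP ->; rewrite add0r ltW.
  have -> : u + 1 *: u1 = inc S (mu + 1) *: u1.
    by rewrite rmorphD rmorph1 scalerDl !scale1r -uE.
  rewrite nrmZ_inc Nu1 mulr1 ger0_norm; rewrite -/mu; lra.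
have phi_neq0 : phi != 0 by rewrite gt_eqF.
pose T0 (x : X) : X := (inc S phi^-1 * f x) *: u1.
have T0l : linear T0.
  move=> k x y; rewrite /T0 linearD functionalZ mulrDr scalerDl scalerA; congr (_ + _).
  by rewrite mulrCA.
pose T : {linear X -> X} := HB.pack T0 (GRing.isLinear.Build _ _ _ _ T0 T0l).
have TE x : T x = (inc S phi^-1 * f x) *: u1 by [].
have NT x : N (T x) = phi^-1 * N (f x).
  by rewrite TE nrmZ Nu1 mulr1 nrmM nrm_inc ger0_norm // invr_ge0 ltW.
have Tb : bounded_map S T.
  exists 1 => x; rewrite NT mul1r ler_pdivrMl //; exact: opN_le.
have T1 : opN S T = 1.
  apply/eqP; rewrite eq_le; apply/andP; split.
    apply: (opN_lub Tb) => x x1; rewrite NT ler_pdivrMl // mulr1; exact: opN_ball.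
  have : phi <= phi * opN S T.
    apply: (opN_lub fb) => x x1; rewrite -ler_pdivrMl // -NT; exact: opN_ball.
  by rewrite -{1}[phi]mulr1 ler_pM2l.
have Tr1 : rank_one T.
  exists u1; first by rewrite -(nrm_eq0 S) Nu1 oner_eq0.
  have [x0 _ x0f] := opN_approx fb phi0.
  have fx0 : f x0 != 0 by rewrite -(nrm_gt0 S) //; move: x0f; rewrite -/phi subrr.
  apply/seteqP; split=> _ [a _ <-]; first by exists (inc S phi^-1 * f a).
  exists ((a * inc S phi / f x0) *: x0) => //.
  rewrite TE functionalZ divfK // [inc S phi^-1 * _]mulrCA -rmorphM mulVf //.
  by rewrite rmorph1 mulr1.
have [[t t1 tE] _] := adp T (proj2 (continuous_bounded_map S T) Tb) Tr1.
(* The final error is 2 * eta * max mu 1 in the norm and eta * phi in the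
   functional; this eta makes both smaller than d. *)
pose eta := d / (2 * (1 + mu + phi)).
have eta0 : 0 < eta by apply: divr_gt0 => //; lra.
have etaE : 2 * eta * (1 + mu + phi) = d by rewrite /eta; field; lra.
have Gb x : N x <= 1 -> N (x + t *: T x) <= 2.
  move=> x1; apply: le_trans (nrmD _ _ _) _; rewrite nrmZ_unit //.
  have := opN_ball Tb x1; rewrite T1; lra.
have [GE _ Glub] := opnormP Gb.
have {GE} G2 : opN S (fun x => x + t *: T x) = 2.
  by rewrite /opN tE (opnorm_inc Tb) T1 -[1 in LHS](rmorph1 (inc S)) -rmorphD rp_inc.
have [z z1 zG] : exists2 z, N z <= 1 & 2 - eta < N (z + t *: T z).
  apply: contrapT => /forall2NP noz.
  suff : opN S (fun x => x + t *: T x) <= 2 - eta by rewrite G2; lra.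
  by apply: Glub => x x1; have [//|/negP] := noz x; rewrite -leNgt.
pose c : K := inc S phi^-1 * f z.
have NcE : N c = phi^-1 * N (f z) by rewrite nrmM nrm_inc ger0_norm // invr_ge0 ltW.
have Nc1 : N c <= 1 by rewrite NcE ler_pdivrMl // mulr1; exact: opN_ball.
have Nc : 1 - eta < N c.
  have := nrmD S z (t *: T z).
  have -> : N (t *: T z) = N c by rewrite nrmZ_unit // NT NcE.
  lra.
have [s s1 sc] := exists_phase S c.
have s0 : s != 0 by rewrite -(nrm_gt0 S) unit_nrm.
have t0 : t != 0 by rewrite -(nrm_gt0 S) unit_nrm.
pose w : K := t / s.
have w1 : unit_scalars w by apply: unit_scalarsM => //; exact: unit_scalarsV.
have w0 : w != 0 by rewrite -(nrm_gt0 S) unit_nrm.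
have tcE : t * c = w * inc S (N c) by rewrite -sc /w mulrA divfK.
exists (s *: z), (w^-1 / s); split.
- by rewrite nrmZ_unit.
- by apply: unit_scalarsM; exact: unit_scalarsV.
- move=> b b1; apply: (le_trans (fphi b b1)).
  have -> : f (s *: z) = inc S (phi * N c).
    rewrite functionalZ rmorphM -sc mulrCA; congr (_ * _).
    by rewrite /c mulrA -rmorphM divff // rmorph1 mul1r.
  rewrite rp_inc.
  have : phi * (1 - eta) <= phi * N c by rewrite ler_pM2l // ltW.
  have := mulr_gt0 eta0 mu0; have := mulr_gt0 eta0 phi0; lra.
rewrite scalerA divfK //.
set v := w^-1 *: z.
have Nv : N v <= 1 by rewrite nrmZ_unit //; exact: unit_scalarsV.
have uv : 2 - 2 * eta < N (u1 + v).
  have -> : N (u1 + v) = N (z + w *: u1).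
    rewrite -(nrmZ_unit S (z + w *: u1) (unit_scalarsV w1)).
    by rewrite scalerDr scalerA mulVf // scale1r addrC.
  have : N (z + t *: T z) <= N (z + w *: u1) + (1 - N c).
    have -> : z + t *: T z = (z + w *: u1) - (w * inc S (1 - N c)) *: u1.
      rewrite TE -/c scalerA tcE -addrA -scalerBl rmorphB rmorph1 mulrBr mulr1.
      by rewrite opprB [w + _]addrC subrK.
    apply: le_trans (nrmB _ _ _) _.
    by rewrite -scalerA nrmZ_unit // nrmZ_inc Nu1 mulr1 ger0_norm // subr_ge0.
  lra.
have eta_mu : 0 < eta * mu by exact: mulr_gt0.
have eta_phi : 0 < eta * phi by exact: mulr_gt0.
have [mu1|mu1] := leP 1 mu.
  have -> : u + v = inc S mu *: (u1 + v) - inc S (mu - 1) *: v.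
    rewrite scalerDr -uE rmorphB rmorph1 scalerBl scale1r opprB.
    by rewrite [v - _]addrC addrA addrK.
  have := nrm_dist_le S (inc S mu *: (u1 + v)) (inc S (mu - 1) *: v).
  rewrite !nrmZ_inc !ger0_norm ?(ltW mu0) ?subr_ge0 //.
  have : mu * (2 - 2 * eta) < mu * N (u1 + v) by rewrite ltr_pM2l.
  have : (mu - 1) * N v <= mu - 1 by rewrite ler_piMr // subr_ge0.
  rewrite -/mu; lra.
have -> : u + v = (u1 + v) - inc S (1 - mu) *: u1.
  by rewrite rmorphB rmorph1 scalerBl scale1r -uE opprB [RHS]addrC addrA subrK.
have := nrm_dist_le S (u1 + v) (inc S (1 - mu) *: u1).
rewrite !nrmZ_inc Nu1 mulr1 ger0_norm; last by rewrite subr_ge0 ltW.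
rewrite -/mu; lra.
Qed.

Definition aconv (s : seq X) : set X :=
  smallest [set C : set X | convex_set C] [set t *: u | t in @unit_scalars K & u in [set` s]].

Lemma aconv_convex s : convex_set (aconv s).
Proof.
move=> x y l /set_mem xs /set_mem ys; apply/mem_set => C [cC sC].
by apply/set_mem/cC; apply/mem_set; [apply: xs|apply: ys].
Qed.

Lemma aconv_sub s (C : set X) : convex_set C ->
  (forall t u, unit_scalars t -> u \in s -> C (t *: u)) -> aconv s `<=` C.
Proof.
by move=> cC sC; apply: smallest_sub => // _ [t t1 [u us <-]]; exact: sC.
Qed.

Lemma aconv_mem s t u : unit_scalars t -> u \in s -> aconv s (t *: u).
Proof. by move=> t1 us; apply: sub_gen_smallest; exists t => //; exists u. Qed.

Lemma closed_aconv_convex (A : set X) : convex_set (closed_aconv A).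
Proof.
move=> x y l /set_mem xs /set_mem ys; apply/mem_set => C [[cC vC] sC].
by apply/set_mem/vC; apply/mem_set; [apply: xs|apply: ys].
Qed.

(** The norm of x + sum s is within eps of the largest possible value when
    x is a unit vector; this makes every summand almost maximal for any
    functional norming the sum. *)
Definition aligned (x : X) (eps : R) (s : seq X) :=
  (forall u, u \in s -> N u <= 1) /\ (size s)%:R + 1 - eps < N (x + \sum_(u <- s) u).

(** A position is the absolutely convex hull of a list aligned with x.  Each
    extension costs arbitrarily little, so the slack eps is never used up. *)
Lemma ADP_forcing x eps : eps <= 1 -> alternative_Daugavet X ->
  forcing S [set aconv s | s in aligned x eps].
Proof.
move=> eps1 adp; split=> [_ [s [s1 _] <-]|_ f d [s [s1 xs] <-] fb d0].
  split; first exact: aconv_convex.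
  apply: (@aconv_sub _ [set z | N ((@idfun X : {linear X -> X}) z) <= 1]).
    exact: convex_sublevel.
  by move=> t u t1 /s1 u1 /=; rewrite nrmZ_unit.
set v := x + _ in xs.
have v0 : v != 0 by rewrite -(nrm_gt0 S); apply: le_lt_trans xs; have := ler0n R (size s); lra.
pose e := Num.min d (N v - ((size s)%:R + 1 - eps)).
have e0 : 0 < e by rewrite lt_min d0 subr_gt0.
have ed : e <= d by rewrite ge_min lexx.
have ev : e <= N v - ((size s)%:R + 1 - eps) by rewrite ge_min lexx orbT.
have [z [t [z1 t1 zf vz]]] := ADP_extend adp fb v0 e0.
exists (aconv (t *: z :: s)); split.
- exists (t *: z :: s) => //; split=> [u|].
    by rewrite inE => /predU1P[->|/s1//]; rewrite nrmZ_unit.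
  rewrite big_cons addrCA -/v addrC /= -[(size s).+1%:R]natr1; lra.
- apply: aconv_sub; first exact: aconv_convex.
  by move=> k u k1 us; apply: aconv_mem => //; rewrite inE us orbT.
- exists z; last by move=> b /zf; lra.
  have := aconv_mem (unit_scalarsV t1) (mem_head (t *: z) s).
  by rewrite scalerA mulVf ?scale1r // -(nrm_gt0 S) unit_nrm.
Qed.

(** If one summand fell below 1 - eps, the others, each at most 1, could not
    make up for it. *)
Lemma summands_near_one (s : seq X) (r : X -> R) eps : (forall u, u \in s -> r u <= 1) ->
  (size s)%:R - eps < \sum_(u <- s) r u -> forall u, u \in s -> 1 - eps < r u.
Proof.
elim: s eps => [//|w s IH] eps r1; rewrite big_cons /= -[(size s).+1%:R]natr1 => sr u.
have r1s v : v \in s -> r v <= 1 by move=> vs; apply: r1; rewrite inE vs orbT.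
rewrite inE => /predU1P[->|us].
  have : \sum_(u <- s) r u <= (size s)%:R.
    rewrite -sum1_size natr_sum big_seq [leRHS]big_seq.
    by apply: ler_sum => v vs; exact: r1s.
  lra.
apply: IH => //; have := r1 w (mem_head w s); lra.
Qed.

(** Once y is near the absolutely convex hull of a list s aligned with x, a
    functional norming x + sum s has a slice that contains x and all of s. *)
Lemma ADP_lush (re : K -> K) (reE : forall k, re k = inc S (rp S k)) :
  (forall F A y eps, forcing S F -> F A -> N y <= 1 -> 0 < eps ->
    exists A', [/\ F A', A `<=` A' & exists2 q : X, A' q & N (y - q) < eps]) ->
  alternative_Daugavet X -> lush re X.
Proof.
move=> dense adp x y /(unit_sphereE S) x1 /(unit_sphereE S) y1 eps0 eps00.
have [eps epsE] : exists e, eps0 = inc S e.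
  by exists (rp S eps0); rewrite inc_rp_ge0 // ltW.
have {eps00} eps_gt0 : 0 < eps by rewrite -(inc_lt S) rmorph0 -epsE.
rewrite {}epsE {eps0}.
pose e := Num.min eps 1.
have e0 : 0 < e by rewrite lt_min eps_gt0 ltr01.
have [e_eps e1] : e <= eps /\ e <= 1 by rewrite !ge_min !lexx orbT.
have start : [set aconv s | s in aligned x e] (aconv [::]).
  exists [::] => //; split=> //; rewrite big_nil addr0 x1 /=; lra.
have y_le1 : N y <= 1 by rewrite y1.
have [_ [[s [s1 xs] <-] _ [q qs yq]]] :=
  dense _ _ y eps (ADP_forcing x e1 adp) start y_le1 eps_gt0.
set v := x + _ in xs.
have v0 : v != 0.
  by rewrite -(nrm_gt0 S); apply: le_lt_trans xs; have := ler0n R (size s); lra.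
have [g g1 gv] := norming_functional S v0.
have rg u : N u <= 1 -> rp S (g u) <= 1.
  by move=> u1; apply: le_trans (rp_le_nrm S _) _; apply: le_trans (dual_sphere_le S _ g1) u1.
have large : forall u, u \in x :: s -> 1 - eps < rp S (g u).
  move=> u us; apply: (@le_lt_trans _ _ (1 - e)); first lra.
  apply: (@summands_near_one (x :: s) (fun u => rp S (g u))) us.
    by move=> w; rewrite inE => /predU1P[->|/s1]; [rewrite rg ?x1|exact: rg].
  rewrite big_cons -(raddf_sum (rp S)) -raddfD /= -linear_sum -linearD gv rp_inc.
  by rewrite -[(size s).+1%:R]natr1.
have slice_mem u : u \in x :: s -> slice re g (inc S eps) u.
  move=> us; split.
    apply/(unit_ballE S); move: us; rewrite inE => /predU1P[->|/s1//].
    by rewrite x1.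
  by rewrite reE -[1](rmorph1 (inc S)) -rmorphB inc_lt large.
exists g; split=> //; first exact/slice_mem/mem_head.
apply/dist_ltP.
  exists (1 *: x); apply: closed_aconv_mem; first exact: normr1.
  exact/slice_mem/mem_head.
exists q => //; apply: aconv_sub qs; first exact: closed_aconv_convex.
by move=> t u t1 us; apply: closed_aconv_mem => //; apply: slice_mem; rewrite inE us orbT.
Qed.

End ADPLush.

(** * Spaces with a 1-unconditional basis *)

Section Basis.
Context (R : realType) (K : numFieldType) (S : real_form R K) (X : normedModType K).
Local Notation N := (nrm S).

Lemma expansionE I (e : nat -> X) (a : nat -> K) (x : X) : expansion I e a x <->
  (forall k, ~ I k -> a k = 0) /\
  (forall d, 0 < d -> exists n0, forall n, (n0 <= n)%N ->
    N (x - \sum_(k < n) a k *: e k) < d).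
Proof.
have seriesE n : series (fun k => a k *: e k) n = \sum_(k < n) a k *: e k.
  by rewrite /series /= big_mkord.
split=> -[aI ax]; split=> //.
  move=> d d0.
  have incd0 : 0 < inc S d by rewrite -(rmorph0 (inc S)) inc_lt.
  have [n0 _ n0P] := (cvgrPdist_lt _ _).1 ax _ incd0.
  by exists n0 => n /n0P/=; rewrite seriesE nrm_lt_inc.
apply/cvgrPdist_lt => d d0; have [|n0 n0P] := ax (rp S d).
  by rewrite -(inc_lt S) rmorph0 inc_rp_ge0 // ltW.
by exists n0 => // n /= /n0P; rewrite seriesE nrm_lt_inc inc_rp_ge0 // ltW.
Qed.

(** The coordinates of the basis satisfy the assumptions of [forcing_dense].
    Uniqueness of expansions makes them linear and compatible with truncation;
    the signs (1, ..., 1, -1, -1, ...) give the reflections, and these bound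
    the partial sums and with them the coordinates.  A vanishing basis vector
    would have the zero functional as its coordinate. *)
Lemma basis_forcing_dense : has_one_unconditional_basis X ->
  forall F A (y : X) eps, forcing S F -> F A -> N y <= 1 -> 0 < eps ->
  exists A', [/\ F A', A `<=` A' & exists2 q : X, A' q & N (y - q) < eps].
Proof.
move=> [I [e [[_ basis] uncond]]].
have /choice[c cP] : forall x, exists c, expansion I e c x.
  by move=> x; have [c [? _]] := basis x; exists c.
have cU b x : expansion I e b x -> b = c x.
  by have [c' [_ u]] := basis x => bx; rewrite -(u b bx) -(u (c x) (cP x)).
have cE x := proj1 (expansionE _ _ _ _) (cP x).
have cl k : linear ((fun x => c x k) : X -> K^o).
  move=> t x y; have [xI xP] := cE x; have [yI yP] := cE y.
  have <- // : (fun k => t * c x k + c y k) = c (t *: x + y).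
  apply: cU; apply/expansionE; split=> [j Ij|d d0].
    by rewrite xI // yI // mulr0 addr0.
  pose d1 := d / 2 / (N t + 1).
  have Nt : 0 < N t + 1 by rewrite ltr_wpDl // nrm_ge0.
  have d10 : 0 < d1 by rewrite /d1 !divr_gt0.
  have d20 : 0 < d / 2 by rewrite divr_gt0.
  have [n1 n1P] := xP d1 d10; have [n2 n2P] := yP _ d20.
  exists (maxn n1 n2) => n; rewrite geq_max => /andP[/n1P h1 /n2P h2].
  have -> : \sum_(k < n) (t * c x k + c y k) *: e k =
      t *: (\sum_(k < n) c x k *: e k) + \sum_(k < n) c y k *: e k.
    by rewrite scaler_sumr -big_split; apply: eq_bigr => j _; rewrite scalerDl scalerA.
  rewrite opprD addrACA -scalerBr; apply: le_lt_trans (nrmD _ _ _) _; rewrite nrmZ.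
  have : (N t + 1) * N (x - \sum_(k < n) c x k *: e k) < d / 2.
    by move: h1; rewrite ltr_pdivlMr // mulrC.
  have := nrm_ge0 S (x - \sum_(k < n) c x k *: e k); lra.
have /choice[a aE] : forall k, exists f : {linear X -> K^o}, f = (fun x => c x k) :> (X -> K).
  by move=> k; exact: pack_linear (cl k).
have acE k x : a k x = c x k by rewrite aE.
have PE n x : partial_sum a e n x = \sum_(k < n) c x k *: e k.
  by apply: eq_bigr => k _; rewrite acE.
have P_cvg x d : 0 < d ->
    exists n0, forall n, (n0 <= n)%N -> N (x - partial_sum a e n x) < d.
  by move=> d0; have [_ /(_ d d0)[n0 n0P]] := cE x; exists n0 => n /n0P; rewrite PE.
have P_reflect n x : N (partial_sum a e n x *+ 2 - x) <= N x.
  (* The expansion with signs th converges to 2 P n x - x. *)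
  pose th k : K := if (k < n)%N then 1 else -1.
  have th1 k : th k = 1 \/ th k = -1 by rewrite /th; case: ifP; [left|right].
  have [y /expansionE[_ yP] yx] := uncond x (c x) (cP x) th th1.
  apply/ler_addgt0Pr => d d0; have d20 : 0 < d / 2 by rewrite divr_gt0.
  have [n1 n1P] := yP _ d20; have [n2 n2P] := P_cvg x _ d20.
  pose m := maxn n (maxn n1 n2).
  have nm : (n <= m)%N by exact: leq_maxl.
  have {n1P} := n1P m; rewrite /m !leq_max leqnn orbT => /(_ isT).
  have {n2P} := n2P m; rewrite /m !leq_max leqnn !orbT => /(_ isT).
  rewrite -/m.
  have -> : \sum_(k < m) (th k * c x k) *: e k =
      partial_sum a e n x *+ 2 - partial_sum a e m x.
    rewrite !PE -!(big_mkord xpredT (fun k => c x k *: e k)).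
    rewrite -(big_mkord xpredT (fun k => (th k * c x k) *: e k)).
    rewrite (big_cat_nat (n := n)) //= [X in _ = _ - X](big_cat_nat (n := n)) //=.
    rewrite mulr2n opprD addrA addrK; congr (_ + _).
      by apply: eq_big_nat => k /andP[_ kn]; rewrite /th kn mul1r.
    rewrite -sumrN; apply: eq_big_nat => k /andP[nk _].
    by rewrite /th ltnNge nk /= mulN1r scaleNr.
  set p := partial_sum a e n x; set q := partial_sum a e m x.
  have -> : N x = N y by rewrite /nrm yx.
  move=> xq yq.
  have -> : p *+ 2 - x = y - ((y - (p *+ 2 - q)) + (x - q)).
    by rewrite opprD !opprB addrA [y + _]addrC subrK addrA subrK.
  apply: le_trans (nrmB _ _ _) _; rewrite lerD2l.
  apply: le_trans (nrmD _ _ _) _; lra.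
have cP_trunc m x k : c (partial_sum a e m x) k = if (k < m)%N then c x k else 0.
  have <- // : (fun k => if (k < m)%N then c x k else 0) = c (partial_sum a e m x).
  apply: cU; apply/expansionE; split=> [j Ij|d d0].
    by have [-> // _] := cE x; rewrite if_same.
  exists m => n mn.
  have -> : \sum_(k < n) (if (k < m)%N then c x k else 0) *: e k = partial_sum a e m x.
    rewrite PE -(big_mkord xpredT (fun k => (if (k < m)%N then c x k else 0) *: e k)).
    rewrite -(big_mkord xpredT (fun k => c x k *: e k)) (big_cat_nat (n := m)) //=.
    rewrite [X in _ + X]big_nat_cond [X in _ + X]big1 ?addr0.
      by apply: eq_big_nat => j /andP[_ ->].
    by move=> j /andP[/andP[mj _] _]; rewrite ltnNge mj scale0r.
  by rewrite subrr nrm0.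
have P_P n m x : (n <= m)%N -> partial_sum a e n (partial_sum a e m x) = partial_sum a e n x.
  move=> nm; rewrite [LHS]PE [RHS]PE; apply: eq_bigr => k _.
  by rewrite cP_trunc (leq_trans (ltn_ord k)).
have P_le n x : N (partial_sum a e n x) <= N x.
  have : N (partial_sum a e n x *+ 2) <= N x + N x.
    rewrite -[_ *+ 2](subrK x); apply: le_trans (nrmD _ _ _) _; rewrite lerD2r.
    exact: P_reflect.
  by rewrite -(scaler_nat 2 (partial_sum a e n x)) -(rmorph_nat (inc S)) nrmZ_inc ger0_norm //; lra.
have ab k : bounded_map S (a k).
  have [ek0|ek0] := eqVneq (e k) 0.
    exists 0 => x; rewrite mul0r acE.
    have <- : (fun j => if j == k then 0 else c x j) = c x.
      apply: cU; have [xI xP] := cE x; apply/expansionE; split=> [j /xI ->|d d0].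
        by rewrite if_same.
      have [n0 n0P] := xP d d0; exists n0 => n /n0P; congr (N (_ - _) < _).
      apply: eq_bigr => j _; case: eqP => // ->.
      by rewrite ek0 !scaler0.
    by rewrite eqxx nrm0.
  have Ne : 0 < N (e k) by rewrite nrm_gt0.
  exists (2 / N (e k)) => x; rewrite mulrAC ler_pdivlMr // -nrmZ.
  have -> : a k x *: e k = partial_sum a e k.+1 x - partial_sum a e k x.
    by rewrite /partial_sum big_ord_recr /= addrAC subrr add0r.
  apply: le_trans (nrmB _ _ _) _; have := P_le k x; have := P_le k.+1 x; lra.
move=> F A y eps Ff FA y1 eps0.
exact: (forcing_dense Ff ab P_cvg P_reflect P_P FA y1 eps0).
Qed.

Lemma tfae_of_unconditional_basis (re : K -> K) : (forall k, re k = inc S (rp S k)) ->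
  has_one_unconditional_basis X ->
  [<-> alternative_Daugavet X; lush re X; numerical_index_one X].
Proof.
move=> reE /basis_forcing_dense dense; tfae.
- exact: ADP_lush dense.
- exact: lush_numerical_index_one.
- exact: numerical_index_one_ADP S X.
Qed.

End Basis.

Lemma real_form_of_real (R : realType) :
  exists S : real_form R R, forall k, k = inc S (rp S k).
Proof.
have sqrE (k : R) : `|k| ^+ 2 = k ^+ 2 + (0 * k) ^+ 2.
  by rewrite mul0r expr0n addr0 real_normK ?num_real.
have splitE (k : R) : k = k - 0 * (0 * k) by rewrite mul0r subr0.
by exists (@RealForm R R idfun idfun 0 (fun _ _ => erefl) (fun _ _ => erefl) erefl sqrE
  (fun _ _ => erefl) splitE (or_introl erefl)).
Qed.

Lemma real_form_of_complex (R : realType) :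
  exists S : real_form R R[i], forall k, 'Re k = inc S (rp S k).
Proof.
have Re_morph : zmod_morphism (@complex.Re R : R[i] -> R) by move=> [a b] [c d].
pose re : {additive R[i] -> R} :=
  HB.pack (@complex.Re R : R[i] -> R) (GRing.isZmodMorphism.Build R[i] R _ Re_morph).
have re_scale (a : R) (k : R[i]) : re (a%:C * k) = a * re k.
  by case: k => b c; rewrite /= mul0r subr0.
have sqrE (k : R[i]) : `|k| ^+ 2 = (re k ^+ 2 + re ('i%C * k) ^+ 2)%:C.
  case: k => a b; rewrite -add_Re2_Im2 /=; congr (_%:C).
  by rewrite mul0r mul1r sub0r sqrrN.
have re_ge0 (k : R[i]) : 0 <= k -> (re k)%:C = k.
  by move=> k0; apply: RRe_real; exact: ger0_real.
have splitE (k : R[i]) : k = (re k)%:C - 'i%C * (re ('i%C * k))%:C.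
  case: k => a b; apply/eqP; rewrite eq_complex /=.
  by apply/andP; split; apply/eqP; ring.
have sqr_i : 'i%C * 'i%C = -1 :> R[i] by rewrite -expr2 sqr_i.
exists (@RealForm R R[i] (real_complex R) re 'i%C (@lecR R) re_scale erefl sqrE
  re_ge0 splitE (or_intror sqr_i)) => k.
exact/esym/complexRe.
Qed.

Theorem corollary3p2 (R : realType) :
  (forall X : completeNormedModType R,
     has_one_unconditional_basis X ->
     [<-> alternative_Daugavet X;
          lush (fun t : R => t) X;
          numerical_index_one X]) /\
  (forall X : completeNormedModType R[i],
     has_one_unconditional_basis X ->
     [<-> alternative_Daugavet X;
          lush (fun t : R[i] => 'Re t) X;
          numerical_index_one X]).
Proof.
have [SR SRE] := real_form_of_real R; have [SC SCE] := real_form_of_complex R.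
by split=> X; [exact: tfae_of_unconditional_basis SRE|exact: tfae_of_unconditional_basis SCE].
Qed.
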